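(* Let $H_1,H_2:\overline U\times\mathbb R^n\to\mathbb R$ be smooth and let $c_{11},c_{12},c_{21},c_{22}\in\mathbb R$. Assume: (1) there exist $\beta_1,\beta_2>0$ such that for $j=1,2$, uniformly in $x\in\overline U$, $\lim_{|p|\to+\infty}\left(\beta_j|H_j(x,p)|^2+D_xH_j(x,p)\cdot p\right)=\lim_{|p|\to+\infty}\frac{H_j(x,p)}{|p|}=+\infty$; (2) $c_{12},c_{21}\le0$; (3) there exists $\alpha>0$ such that $c_{11}+c_{12}\ge\alpha$ and $c_{21}+c_{22}\ge\alpha$; (4) there exist $\Phi_1,\Phi_2\in C^2(U)\cap C^1(\overline U)$ with $\Phi_1=\Phi_2=0$ on $\partial U$ and, in $U$, $c_{11}\Phi_1+c_{12}\Phi_2+H_1(x,D\Phi_1)<0$ and $c_{22}\Phi_2+c_{21}\Phi_1+H_2(x,D\Phi_2)<0$. Let $(u_1,u_2)$ be the viscosity solution of $$\begin{cases}c_{11}u_1+c_{12}u_2+H_1(x,Du_1)=0\\c_{21}u_1+c_{22}u_2+H_2(x,Du_2)=0\end{cases}\ \text{in }U,\qquad u_1=u_2=0\text{ on }\partial U,$$ and for $\varepsilon>0$ let $(u_1^\varepsilon,u_2^\varepsilon)$ be the smooth solution of $$\begin{cases}c_{11}u_1^\varepsilon+c_{12}u_2^\varepsilon+H_1(x,Du_1^\varepsilon)=\varepsilon\Delta u_1^\varepsilon\\c_{21}u_1^\varepsilon+c_{22}u_2^\varepsilon+H_2(x,Du_2^\varepsilon)=\varepsilon\Delta u_2^\varepsilon\end{cases}\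 \text{in }U,\qquad u_1^\varepsilon=u_2^\varepsilon=0\text{ on }\partial U.$$ Then there exists a constant $C>0$, independent of $\varepsilon$, such that $$\|u_1^\varepsilon-u_1\|_{L^\infty},\ \|u_2^\varepsilon-u_2\|_{L^\infty}\le C\varepsilon^{1/2}.$$
   Context: $U\subset\mathbb R^n$ ($n\ge2$) is an open bounded domain with smooth boundary. A pair of continuous functions is a viscosity solution of the system if each component is a viscosity solution of its equation, with the other component regarded as a given continuous function. Existence and uniqueness of $(u_1,u_2)$ and of $(u_1^\varepsilon,u_2^\varepsilon)$ under these assumptions is known. *)

(* Defs.v *)
From HB Require Import structures.
From mathcomp Require Import all_boot all_order all_algebra.
From mathcomp Require Import all_classical all_reals all_analysis.

Set Implicit Arguments.
Unset Strict Implicit.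
Unset Printing Implicit Defensive.

Import Order.TTheory GRing.Theory Num.Theory.
Import numFieldNormedType.Exports.

Local Open Scope classical_set_scope.
Local Open Scope ring_scope.

(* The library norm on 'rV[R]_n is the max norm; it induces the usual topology
   of R^n, but the |p| of the growth conditions is the Euclidean norm below. *)
Definition dotv (R : realType) (n : nat) (p q : 'rV[R]_n) : R :=
  \sum_(i < n) p 0 i * q 0 i.

Definition enorm (R : realType) (n : nat) (p : 'rV[R]_n) : R :=
  Num.sqrt (dotv p p).

Definition partial (R : realType) (n : nat) (i : 'I_n) (f : 'rV[R]_n -> R)
    (x : 'rV[R]_n) : R :=
  'D_(delta_mx 0 i) f x.

Definition grad (R : realType) (n : nat) (f : 'rV[R]_n -> R) (x : 'rV[R]_n) :
    'rV[R]_n :=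
  \row_(i < n) partial i f x.

Definition laplacian (R : realType) (n : nat) (f : 'rV[R]_n -> R)
    (x : 'rV[R]_n) : R :=
  \sum_(i < n) partial i (partial i f) x.

(* The gradient of f up to the boundary of U: the limit at x of the gradient
   taken at points of U.  At a point of U where f is C^1 it is [grad f x]. *)
Definition grad_closure (R : realType) (n : nat) (U : set 'rV[R]_n)
    (f : 'rV[R]_n -> R) (x : 'rV[R]_n) : 'rV[R]_n :=
  \row_(i < n) lim (partial i f y @[y --> within U (nbhs x)]).

(* f is C^k in the open set O of a finite-dimensional space V.  All directional
   derivatives are used instead of those along a basis, so that the same
   definition serves for R^n and for R^n x R^n. *)
Fixpoint Ck (R : realType) (V : normedModType R) (k : nat) (O : set V)
    (f : V -> R) : Prop :=
  (forall x, O x -> {for x, continuous f}) /\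
  if k is k'.+1 then
    forall v, (forall x, O x -> derivable f x v) /\ Ck k' O (fun x => 'D_v f x)
  else True.

(* f is C^k up to the boundary of the open set O: f is continuous on the
   closure of O, and its derivatives in O of order at most k extend to
   continuous functions on the closure of O. *)
Fixpoint Ck_closure (R : realType) (V : normedModType R) (k : nat) (O : set V)
    (f : V -> R) : Prop :=
  {within closure O, continuous f} /\
  if k is k'.+1 then
    forall v, (forall x, O x -> derivable f x v) /\
      exists2 g : V -> R, (forall x, O x -> g x = 'D_v f x) & Ck_closure k' O g
  else True.

Definition smooth (R : realType) (V : normedModType R) (O : set V)
    (f : V -> R) : Prop :=
  forall k, Ck k O f.

Definition smooth_closure (R : realType) (V : normedModType R) (O : set V)
    (f : V -> R) : Prop :=
  forall k, Ck_closure k O f.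

Definition bdry (T : topologicalType) (U : set T) : set T :=
  closure U `\` interior U.

(* Near each boundary point, after relabelling and reorienting the axes, U is
   the set of points above the graph of a smooth function of n - 1 variables;
   [col' i x] is x with its i-th coordinate removed. *)
Definition smooth_boundary (R : realType) (n : nat) (U : set 'rV[R]_n) : Prop :=
  forall x0, bdry U x0 ->
    exists (r : R) (i : 'I_n) (s : bool) (g : 'rV[R]_n.-1 -> R),
      [/\ 0 < r, smooth [set: 'rV[R]_n.-1] g &
          forall x, enorm (x - x0) < r ->
            (U x <-> g (col' i x) < (-1) ^+ s * x 0 i)].

Definition smooth_bounded_domain (R : realType) (n : nat) (U : set 'rV[R]_n) :
    Prop :=
  [/\ open U, U !=set0, connected U, bounded_set U & smooth_boundary U].

Definition unif_pinfty (R : realType) (n : nat) (K : set 'rV[R]_n)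
    (G : 'rV[R]_n -> 'rV[R]_n -> R) : Prop :=
  forall M : R, exists r : R,
    forall x p, K x -> r <= enorm p -> M <= G x p.

(* F x (u x) (Du x) = 0 in U, tested against C^1 functions. *)
Definition visc_subsol (R : realType) (n : nat) (U : set 'rV[R]_n)
    (F : 'rV[R]_n -> R -> 'rV[R]_n -> R) (u : 'rV[R]_n -> R) : Prop :=
  forall (phi : 'rV[R]_n -> R) (x0 : 'rV[R]_n), Ck 1 U phi -> U x0 ->
    (\forall x \near x0, u x - phi x <= u x0 - phi x0) ->
    F x0 (u x0) (grad phi x0) <= 0.

Definition visc_supersol (R : realType) (n : nat) (U : set 'rV[R]_n)
    (F : 'rV[R]_n -> R -> 'rV[R]_n -> R) (u : 'rV[R]_n -> R) : Prop :=
  forall (phi : 'rV[R]_n -> R) (x0 : 'rV[R]_n), Ck 1 U phi -> U x0 ->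
    (\forall x \near x0, u x0 - phi x0 <= u x - phi x) ->
    0 <= F x0 (u x0) (grad phi x0).

Definition visc_sol (R : realType) (n : nat) (U : set 'rV[R]_n)
    (F : 'rV[R]_n -> R -> 'rV[R]_n -> R) (u : 'rV[R]_n -> R) : Prop :=
  visc_subsol U F u /\ visc_supersol U F u.

Definition visc_system_sol (R : realType) (n : nat) (U : set 'rV[R]_n)
    (H1 H2 : 'rV[R]_n -> 'rV[R]_n -> R) (c11 c12 c21 c22 : R)
    (u1 u2 : 'rV[R]_n -> R) : Prop :=
  [/\ {within closure U, continuous u1} /\ {within closure U, continuous u2},
      visc_sol U (fun x r p => c11 * r + c12 * u2 x + H1 x p) u1,
      visc_sol U (fun x r p => c21 * u1 x + c22 * r + H2 x p) u2 &
      forall x, bdry U x -> u1 x = 0 /\ u2 x = 0].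

Definition smooth_system_sol (R : realType) (n : nat) (U : set 'rV[R]_n)
    (H1 H2 : 'rV[R]_n -> 'rV[R]_n -> R) (c11 c12 c21 c22 : R) (eps : R)
    (v1 v2 : 'rV[R]_n -> R) : Prop :=
  [/\ smooth U v1 /\ smooth U v2,
      {within closure U, continuous v1} /\ {within closure U, continuous v2},
      forall x, U x ->
        c11 * v1 x + c12 * v2 x + H1 x (grad v1 x) = eps * laplacian v1 x /\
        c21 * v1 x + c22 * v2 x + H2 x (grad v2 x) = eps * laplacian v2 x &
      forall x, bdry U x -> v1 x = 0 /\ v2 x = 0].

(* Sets of n-dimensional Lebesgue measure zero, through countable coverings by
   boxes of arbitrarily small total volume. *)
Definition null_set (R : realType) (n : nat) (A : set 'rV[R]_n) : Prop :=
  forall e : R, 0 < e -> exists a b : nat -> 'rV[R]_n,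
    [/\ forall k i, a k 0 i <= b k 0 i,
        A `<=` \bigcup_k [set x | forall i, a k 0 i <= x 0 i <= b k 0 i] &
        (\sum_(0 <= k <oo) (\prod_(i < n) (b k 0 i - a k 0 i))%:E <= e%:E)%E].

Definition Linfty_norm (R : realType) (n : nat) (U : set 'rV[R]_n)
    (f : 'rV[R]_n -> R) : \bar R :=
  ereal_inf [set M%:E | M in
    [set M : R | 0 <= M /\ null_set (U `&` [set x | M < `|f x|])]].

(* Main.v *)
Require Import Defs.
From HB Require Import structures.
From mathcomp Require Import all_boot all_order all_algebra.
From mathcomp Require Import all_classical all_reals all_analysis.
From mathcomp Require Import ring lra.
Import Order.TTheory GRing.Theory Num.Theory.
Import numFieldNormedType.Exports.
Local Open Scope classical_set_scope.
Local Open Scope ring_scope.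

Set Implicit Arguments.
Unset Strict Implicit.
Unset Printing Implicit Defensive.

(** Doubling of variables gives the rate for viscous solutions [v] as soon as the
    viscosity solution [u] is Lipschitz up to the boundary.

    Lipschitz bound ([coercive_lipschitz]).  Where a paraboloid touches [u] from
    above, the equation bounds [H x p] from above, so the superlinear growth of
    [H] bounds the slope [p].  Sup-convolution turns this bound on the contact
    slopes into a Lipschitz bound along segments of U, and the interior cones of
    a smooth domain ([uniform_cone]) carry it to the closure of U.

    Comparison ([doubling]).  Put [dl = sqrt eps], let [xh] be a point where the
    largest of the functions [u1 - v1], [u2 - v2] is maximal, say [u1 - v1] with
    value [m], and let [e] be the axis of an interior cone valid near [xh].
    Maximise, over the closure of U,
      [u1 x - v1 y - |x - y - lam dl e|^2 / (2 dl) - K dl |y - xh|^2].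
    The Lipschitz bound makes [|x - y|] of order [dl] at a maximum point, and for
    [lam] large it puts [x] in the cone with vertex [y], hence inside U even when
    [y] is on the boundary.  If [y] is on the boundary, [v1 y = u1 y = 0] and [m]
    is at most a Lipschitz increment of [u1].  Otherwise the equation of [u1] at
    [x] and that of [v1] at [y] can be subtracted: the gradients differ by
    [O(dl)], the Laplacian of [v1] at [y] is at least [- n / dl - O(dl)], so that
    the viscous term costs [eps n / dl = n dl], and the remaining differences are
    Lipschitz increments.  As [c12 <= 0] and [c11 + c12 >= alpha], the zeroth
    order terms are at least [alpha m - O(dl)], whence [m = O(dl)].

    Large values of eps are covered by the maximum principle ([max_principle]).
    The lower bound is the upper bound for [- u] and [- v], which solve the
    system with Hamiltonians [- H x (- p)] ([reflectH]); stating both solutions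
    as [paraboloid_subsol] makes the two halves instances of [one_sided_rate].

    Lengths are measured in the max norm, which differs from the Euclidean norm
    by a factor depending on n; the penalties use the Euclidean [dotv], which is
    smooth. *)

(** * Max norm and scalar product *)

Lemma coord_le_norm (R : realType) (n : nat) (x : 'rV[R]_n) (i : 'I_n) :
  `|x 0 i| <= `|x|.
Proof.
rewrite {2}/Num.norm /= mx_normrE.
exact: (@le_bigmax _ _ _ 0 (fun ij : 'I_1 * 'I_n => `|x ij.1 ij.2|) (0, i)).
Qed.

Lemma norm_le_coord (R : realType) (n : nat) (x : 'rV[R]_n) (c : R) :
  0 <= c -> (forall i, `|x 0 i| <= c) -> `|x| <= c.
Proof.
move=> c0 hx; rewrite /Num.norm /= mx_normrE.
by apply: bigmax_le => // -[i j] _ /=; rewrite (ord1 i).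
Qed.

Lemma dotvC (R : realType) (n : nat) (p q : 'rV[R]_n) : dotv p q = dotv q p.
Proof. by apply: eq_bigr => i _; rewrite mulrC. Qed.

Lemma dotvDl (R : realType) (n : nat) (p q r : 'rV[R]_n) :
  dotv (p + q) r = dotv p r + dotv q r.
Proof. by rewrite -big_split; apply: eq_bigr => i _; rewrite mxE mulrDl. Qed.

Lemma dotvZl (R : realType) (n : nat) (a : R) (p q : 'rV[R]_n) :
  dotv (a *: p) q = a * dotv p q.
Proof. by rewrite mulr_sumr; apply: eq_bigr => i _; rewrite mxE mulrA. Qed.

Lemma dotvDr (R : realType) (n : nat) (p q r : 'rV[R]_n) :
  dotv p (q + r) = dotv p q + dotv p r.
Proof. by rewrite dotvC dotvDl !(dotvC p). Qed.

Lemma dotvZr (R : realType) (n : nat) (a : R) (p q : 'rV[R]_n) :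
  dotv p (a *: q) = a * dotv p q.
Proof. by rewrite dotvC dotvZl (dotvC p). Qed.

Lemma dotvNl (R : realType) (n : nat) (p q : 'rV[R]_n) :
  dotv (- p) q = - dotv p q.
Proof. by rewrite -scaleN1r dotvZl mulN1r. Qed.

Lemma dotvNr (R : realType) (n : nat) (p q : 'rV[R]_n) :
  dotv p (- q) = - dotv p q.
Proof. by rewrite dotvC dotvNl (dotvC p). Qed.

Lemma dotv_delta (R : realType) (n : nat) (p : 'rV[R]_n) (i : 'I_n) :
  dotv p (delta_mx 0 i) = p 0 i.
Proof.
rewrite /dotv (bigD1 i) //= mxE !eqxx mulr1 big1 ?addr0// => j ji.
by rewrite mxE (negPf ji) andbF mulr0.
Qed.

Lemma dotv_ge0 (R : realType) (n : nat) (p : 'rV[R]_n) : 0 <= dotv p p.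
Proof. by apply: sumr_ge0 => i _; rewrite -expr2 sqr_ge0. Qed.

Lemma norm_le_dotv (R : realType) (n : nat) (p : 'rV[R]_n) :
  `|p| ^+ 2 <= dotv p p.
Proof.
rewrite -(sqr_sqrtr (dotv_ge0 p)) ler_pXn2r ?nnegrE ?sqrtr_ge0//.
apply: norm_le_coord; first exact: sqrtr_ge0.
move=> i; rewrite -sqrtr_sqr ler_wsqrtr// /dotv (bigD1 i)//= -expr2 lerDl.
by apply: sumr_ge0 => j _; rewrite -expr2 sqr_ge0.
Qed.

Lemma norm_le_enorm (R : realType) (n : nat) (p : 'rV[R]_n) : `|p| <= enorm p.
Proof.
rewrite /enorm -[leLHS]ger0_norm// -sqrtr_sqr ler_wsqrtr//.
exact: norm_le_dotv.
Qed.

Lemma dotv_le_norm (R : realType) (n : nat) (p q : 'rV[R]_n) :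
  `|dotv p q| <= n%:R * `|p| * `|q|.
Proof.
apply: (le_trans (ler_norm_sum _ _ _)).
apply: (@le_trans _ _ (\sum_(i < n) `|p| * `|q|)).
  apply: ler_sum => i _; rewrite normrM.
  by apply: ler_pM => //; exact: coord_le_norm.
by rewrite sumr_const card_ord -mulrA mulr_natl.
Qed.

Lemma dotv0l (R : realType) (n : nat) (p : 'rV[R]_n) : dotv 0 p = 0.
Proof. by rewrite /dotv big1// => i _; rewrite mxE mul0r. Qed.

Lemma dotv0r (R : realType) (n : nat) (p : 'rV[R]_n) : dotv p 0 = 0.
Proof. by rewrite dotvC dotv0l. Qed.

Lemma dotv_sqrD (R : realType) (n : nat) (p q : 'rV[R]_n) :
  dotv (p + q) (p + q) = dotv p p + 2 * dotv p q + dotv q q.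
Proof. rewrite !(dotvDl, dotvDr) (dotvC q p); ring. Qed.

Lemma enorm_le_norm (R : realType) (n : nat) (p : 'rV[R]_n) :
  enorm p <= n%:R * `|p|.
Proof.
have np : 0 <= n%:R * `|p| by rewrite mulr_ge0.
rewrite /enorm -[leRHS]ger0_norm// -sqrtr_sqr ler_wsqrtr//.
rewrite (le_trans (ler_norm _))// (le_trans (dotv_le_norm _ _))//.
rewrite exprMn expr2 -mulrA -expr2 -mulrA; case: n p np => [|n] p _.
  by rewrite !mul0r.
rewrite ler_wpM2l// -[leLHS]mul1r ler_wpM2r ?sqr_ge0//.
by rewrite ler1n.
Qed.

Lemma norm_delta_le1 (R : realType) (n : nat) (i : 'I_n) :
  `|delta_mx 0 i : 'rV[R]_n| <= 1.
Proof.
apply: norm_le_coord => // j; rewrite mxE eqxx /=.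
by case: (_ == _); rewrite ?normr1 ?normr0.
Qed.

(** * Continuity and compactness *)

Lemma within_continuousP (R : realType) (V : normedModType R) (A : set V)
    (f : V -> R) :
  {within A, continuous f} <->
  forall x, A x -> forall e : R, 0 < e -> exists2 d : R, 0 < d &
    forall y, A y -> `|x - y| < d -> `|f x - f y| < e.
Proof.
split=> [/subspace_continuousP cf x Ax e e0|h].
  have /cvgrPdist_lt /(_ e e0) := cf x Ax.
  rewrite near_withinE => /nbhs_normP[d /= d0 hd].
  by exists d => // y Ay xy; exact: hd.
apply/subspace_continuousP => x Ax; apply/cvgrPdist_lt => e e0.
rewrite near_withinE; apply/nbhs_normP.
by have [d d0 hd] := h x Ax e e0; exists d => // y /= xy Ay; exact: hd.
Qed.

Lemma closure_approx (R : realType) (V : normedModType R) (U : set V) (z : V)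
    (t : R) : closure U z -> 0 < t -> exists2 z', U z' & `|z - z'| < t.
Proof.
move=> cz t0; have [z' [Uz' bz']] := cz _ (nbhsx_ballx z t t0).
by exists z' => //; move: bz'; rewrite -ball_normE.
Qed.

Lemma ball_in_open (R : realType) (V : normedModType R) (U : set V) (x : V) :
  open U -> U x -> exists2 r : R, 0 < r & forall y, `|y - x| < r -> U y.
Proof.
move=> oU Ux; have /nbhs_normP[r /= r0 hr] := open_nbhs_nbhs (conj oU Ux).
by exists r => // y yx; apply: hr; rewrite /= distrC.
Qed.

Lemma compact_closure_bounded (R : realType) (n : nat) (U : set 'rV[R]_n) :
  bounded_set U -> compact (closure U).
Proof.
move=> [M [Mr hM]]; apply: bounded_closed_compact; last exact: closed_closure.
exists (M + 1); split; first exact: num_real.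
move=> y My x cx; apply/ler_addgt0Pr => e e0.
have [z Uz xz] := closure_approx cx e0.
have My' : M < y by apply: lt_trans My; rewrite ltrDl.
have /= zy := hM y My' z Uz.
rewrite -(subrK z x) addrC (le_trans (ler_normD _ _))//.
by rewrite lerD// ltW.
Qed.

Lemma compact_continuous_bounded (R : realType) (T : topologicalType)
    (K : set T) (f : T -> R) :
  compact K -> {within K, continuous f} ->
  exists2 M : R, 0 <= M & forall z, K z -> `|f z| <= M.
Proof.
move=> cK cf; have [K0|/set0P/negP/negPn/eqP ->] := pselect (K !=set0);
  last by exists 0.
have [b _ hb] := compact_EVT_max K0 cK cf.
have [c _ hc] := compact_EVT_min K0 cK cf.
exists (`|f b| + `|f c|); first by rewrite addr_ge0.
move=> z Kz; have zK : z \in K by rewrite inE.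
have h1 := hb z zK; have h2 := hc z zK.
have h3 := ler_norm (f b); have h4 := ler_norm (- f c); rewrite normrN in h4.
have h5 := normr_ge0 (f b); have h6 := normr_ge0 (f c).
by rewrite ler_norml; apply/andP; split; lra.
Qed.

Lemma max_of_two (R : realType) (n : nat) (K : set 'rV[R]_n)
    (f1 f2 : 'rV[R]_n -> R) :
  K !=set0 -> compact K -> {within K, continuous f1} ->
  {within K, continuous f2} ->
  exists2 xh, K xh & (forall y, K y -> f1 y <= f1 xh /\ f2 y <= f1 xh) \/
    (forall y, K y -> f2 y <= f2 xh /\ f1 y <= f2 xh).
Proof.
move=> K0 cK c1 c2.
have [x1 + h1] := compact_EVT_max K0 cK c1; rewrite inE => Kx1.
have [x2 + h2] := compact_EVT_max K0 cK c2; rewrite inE => Kx2.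
have {}h1 y : K y -> f1 y <= f1 x1 by move=> Ky; apply: h1; rewrite inE.
have {}h2 y : K y -> f2 y <= f2 x2 by move=> Ky; apply: h2; rewrite inE.
have [le|/ltW le] := leP (f2 x2) (f1 x1).
  by exists x1 => //; left => y Ky; rewrite h1// (le_trans (h2 y Ky)).
by exists x2 => //; right => y Ky; rewrite h2// (le_trans (h1 y Ky)).
Qed.

Lemma within_continuousN (R : realType) (n : nat) (K : set 'rV[R]_n)
    (u : 'rV[R]_n -> R) :
  {within K, continuous u} -> {within K, continuous (\- u)}.
Proof. by move=> cu x; apply: cvgN; exact: cu. Qed.

Lemma cvg_dotv (R : realType) (n : nat) (T : Type) (F : set_system T)
    (p q : T -> 'rV[R]_n) (a b : 'rV[R]_n) : Filter F ->
  p x @[x --> F] --> a -> q x @[x --> F] --> b ->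
  dotv (p x) (q x) @[x --> F] --> dotv a b.
Proof.
move=> FF pa qb; apply: cvg_big => [|i _]; first exact: add_continuous.
apply: cvgM.
  exact: (@cvg_comp _ _ _ p (fun M : 'rV[R]_n => M 0 i) _ _ _ pa
    (@coord_continuous R 1 n 0 i a)).
exact: (@cvg_comp _ _ _ q (fun M : 'rV[R]_n => M 0 i) _ _ _ qb
  (@coord_continuous R 1 n 0 i b)).
Qed.

(** * Mean value bounds *)

(** A mean value inequality that asks only for a bound on the slopes seen from
    each point, so that it covers both C^1 functions and functions controlled
    up to a quadratic error. *)
Lemma slope_bound (R : realType) (f : R -> R) (L : R) :
  (forall t : R, 0 <= t <= 1 -> forall e : R, 0 < e -> exists2 d : R, 0 < d &
    forall s : R, 0 <= s <= 1 -> `|s - t| < d ->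
      `|f s - f t| <= (L + e) * `|s - t|) ->
  0 <= L -> `|f 1 - f 0| <= L.
Proof.
move=> hf L0; apply/ler_addgt0Pr => e e0.
pose S := [set t : R | 0 <= t <= 1 /\
  forall s : R, 0 <= s <= t -> `|f s - f 0| <= (L + e) * s].
have S0 : S 0.
  split; first by rewrite lexx ler01.
  by move=> s /le_anti <-; rewrite subrr normr0 mulr0.
have Sub : has_sup S by split; [exists 0 | exists 1 => t [/andP[]]].
set m := sup S.
have m0 : 0 <= m by apply: ub_le_sup => //; case: Sub.
have m1 : m <= 1 by apply: sup_le_ub; [exists 0 | move=> t [/andP[]]].
have m01 : 0 <= m <= 1 by rewrite m0.
have [d d0 hd] := hf m m01 e e0.
have below s : 0 <= s -> s < m -> `|f s - f 0| <= (L + e) * s.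
  rewrite -subr_gt0 => s0 sm; have [t [t01 ht] st] := sup_adherent sm Sub.
  by apply: ht; rewrite s0 ltW// (le_lt_trans _ st)// opprB addrC subrK.
(* the slope bound at [m] carries the bound from just below [m] to [m], and then
   beyond [m] unless [m = 1] *)
have atm : `|f m - f 0| <= (L + e) * m.
  have [->|mN0] := eqVneq m 0; first by rewrite subrr normr0 mulr0.
  have mgt0 : 0 < m by rewrite lt_neqAle eq_sym mN0.
  pose s := Num.max 0 (m - d / 2).
  have s0 : 0 <= s by rewrite le_max lexx.
  have sm : s < m by rewrite gt_max mgt0 /=; lra.
  have sd : `|s - m| < d.
    rewrite distrC gtr0_norm ?subr_gt0//.
    have : m - d / 2 <= s by rewrite le_max lexx orbT.
    lra.
  have s01 : 0 <= s <= 1 by rewrite s0 /=; lra.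
  have h1 := hd s s01 sd.
  have h2 := below s s0 sm.
  have -> : f m - f 0 = (f s - f 0) - (f s - f m) by ring.
  apply: (le_trans (ler_normB _ _)).
  rewrite (distrC s m) (@gtr0_norm _ (m - s)) ?subr_gt0// in h1.
  have -> : (L + e) * m = (L + e) * s + (L + e) * (m - s) by ring.
  exact: lerD.
have [m1e|mlt] := eqVneq m 1; first by rewrite m1e mulr1 in atm.
have {mlt}mlt : m < 1 by rewrite lt_neqAle mlt.
pose t := Num.min 1 (m + d / 2).
have mt : m < t by rewrite lt_min mlt /=; lra.
have St : S t.
  split; first by rewrite (le_trans m0 (ltW mt)) ge_min lexx.
  move=> s /andP[s0 st]; have [sm|ms|->//] := ltgtP s m; first exact: below.
  have t1 : t <= 1 by rewrite ge_min lexx.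
  have td : t <= m + d / 2 by rewrite ge_min lexx orbT.
  have s01 : 0 <= s <= 1 by rewrite s0 /=; lra.
  have sd : `|s - m| < d by rewrite gtr0_norm ?subr_gt0//; lra.
  have := hd s s01 sd; rewrite (@gtr0_norm _ (s - m)) ?subr_gt0// => h1.
  have -> : f s - f 0 = (f s - f m) + (f m - f 0) by ring.
  apply: (le_trans (ler_normD _ _)).
  have -> : (L + e) * s = (L + e) * (s - m) + (L + e) * m by ring.
  exact: lerD.
have : t <= m by apply: ub_le_sup => //; case: Sub.
by rewrite leNgt mt.
Qed.

Lemma derive_expand (R : realType) (V : normedModType R) (f : V -> R)
    (y v : V) (e : R) :
  derivable f y v -> 0 < e -> exists2 d : R, 0 < d &
  forall h : R, `|h| < d ->
    `|f (y + h *: v) - f y - h * 'D_v f y| <= e * `|h|.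
Proof.
move=> df e0; have /cvgrPdist_le /(_ e e0) := df.
rewrite /dnbhs near_withinE => /nbhs_normP[d /= d0 hd].
exists d => // h hh; have [->|h0] := eqVneq h 0.
  by rewrite scale0r addr0 subrr mul0r subrr normr0 mulr0.
have := hd h; rewrite /= sub0r normrN => /(_ hh h0).
rewrite -(ler_pM2r (_ : 0 < `|h|)) ?normr_gt0// -normrM distrC.
apply: le_trans; rewrite le_eqVlt; apply/orP; left; apply/eqP; congr `|_|.
rewrite mulrBl (mulrC _ h) (mulrC _ h) /GRing.scale /= mulrA divff// mul1r.
by rewrite (addrC y).
Qed.

Lemma mvt_line (R : realType) (V : normedModType R) (f : V -> R) (z v : V)
    (c B : R) :
  (forall t : R, 0 <= t <= 1 -> derivable f (z + (t * c) *: v) v /\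
     `|'D_v f (z + (t * c) *: v)| <= B) ->
  `|f (z + c *: v) - f z| <= B * `|c|.
Proof.
move=> h; have B0 : 0 <= B.
  by have [|_] := h 0; [rewrite lexx ler01 | exact: le_trans].
pose F t := f (z + (t * c) *: v).
have -> : f (z + c *: v) - f z = F 1 - F 0.
  by rewrite /F mul1r mul0r scale0r addr0.
apply: slope_bound; last by rewrite mulr_ge0.
move=> t /h[dft Dt] e e0.
have c1 : 0 < `|c| + 1 by rewrite ltr_wpDl.
have [d d0 hd] := derive_expand dft (divr_gt0 e0 c1).
exists (d / (`|c| + 1)); first exact: divr_gt0.
move=> s _ st; set y := z + (t * c) *: v in dft Dt hd.
have Fs : F s = f (y + ((s - t) * c) *: v).
  by rewrite /F /y -addrA -scalerDl -mulrDl addrCA subrr addr0.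
have Ft : F t = f y by [].
have hs : `|(s - t) * c| < d.
  rewrite normrM; move: st; rewrite ltr_pdivlMr//; apply: le_lt_trans.
  by rewrite ler_wpM2l// lerDl.
have := hd _ hs; rewrite -Fs -Ft => hfin.
have -> : F s - F t = (F s - F t - (s - t) * c * 'D_v f y)
                      + (s - t) * c * 'D_v f y by ring.
apply: (le_trans (ler_normD _ _)).
rewrite [leRHS]mulrDl addrC; apply: lerD.
  rewrite !normrM mulrC [leRHS]mulrAC -[leRHS]mulrA.
  by rewrite [leLHS]mulrC [leRHS]mulrC; apply: ler_wpM2l; rewrite ?mulr_ge0.
apply: (le_trans hfin); rewrite normrM.
have -> : e / (`|c| + 1) * (`|s - t| * `|c|)
          = (e * `|s - t|) * (`|c| / (`|c| + 1)) by ring.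
rewrite -[leRHS]mulr1 ler_wpM2l ?mulr_ge0 ?(ltW e0)//.
by rewrite ler_pdivrMr// mul1r lerDl.
Qed.

(** Walking from a point to another along the vectors of a basis, one direction
    at a time, turns bounds on finitely many directional derivatives into a
    Lipschitz bound. *)
Lemma walk_bound (R : realType) (V : normedModType R) (f : V -> R) (z0 : V)
    (r B : R) (s : seq (R * V)) (z : V) :
  (forall y cv, `|y - z0| < r -> cv \in s ->
    derivable f y cv.2 /\ `|'D_(cv.2) f y| <= B) ->
  (forall cv, cv \in s -> `|cv.2| <= 1) ->
  `|z - z0| + \sum_(cv <- s) `|cv.1| < r ->
  `|f (z + \sum_(cv <- s) cv.1 *: cv.2) - f z| <= B * \sum_(cv <- s) `|cv.1|.
Proof.
elim: s z => [|[c v] s IH] z h hs.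
  by rewrite !big_nil !addr0 subrr normr0 mulr0.
rewrite !big_cons /= addrA => hr.
have v1 : `|v| <= 1 by apply: (hs (c, v)); rewrite mem_head.
have S0 : 0 <= \sum_(cv <- s) `|cv.1| by apply: sumr_ge0.
have near t : 0 <= t <= 1 -> `|z + (t * c) *: v - z0| <= `|z - z0| + `|c|.
  move=> /andP[t0 t1]; rewrite addrAC (le_trans (ler_normD _ _))// lerD2l.
  rewrite normrZ normrM (ger0_norm t0) -[leRHS]mulr1 ler_pM ?mulr_ge0//.
  by rewrite -[leRHS]mul1r ler_wpM2r.
have step : `|f (z + c *: v) - f z| <= B * `|c|.
  apply: mvt_line => t t01; apply: (h _ (c, v)); last exact: mem_head.
  apply: (le_lt_trans (near _ t01)); apply: le_lt_trans hr.
  by rewrite lerDl.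
have rest : `|f (z + c *: v + \sum_(cv <- s) cv.1 *: cv.2) - f (z + c *: v)|
            <= B * \sum_(cv <- s) `|cv.1|.
  apply: IH => [y cv hy cvs|cv cvs|].
  - by apply: h => //; rewrite in_cons cvs orbT.
  - by apply: hs; rewrite in_cons cvs orbT.
  - apply: le_lt_trans hr; rewrite lerD2r.
    by have := near 1; rewrite mul1r; apply; rewrite ler01 lexx.
rewrite addrA -[X in `|X|](subrKA (f (z + c *: v))) mulrDr.
by rewrite [leRHS]addrC (le_trans (ler_normD _ _))// lerD.
Qed.

Lemma lipschitz_of_basis (R : realType) (V : normedModType R) (I : finType)
    (b : I -> V) (coef : I -> V -> R) (f : V -> R) (z0 : V) (r B : R) :
  (forall i, `|b i| <= 1) -> (forall i z, `|coef i z| <= `|z|) ->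
  (forall z, z = \sum_i coef i z *: b i) -> 0 <= B ->
  (forall y i, `|y - z0| < r ->
    derivable f y (b i) /\ `|'D_(b i) f y| <= B) ->
  forall z z', `|z - z0| < r / (2 * #|I|%:R + 1) ->
    `|z' - z0| < r / (2 * #|I|%:R + 1) ->
  `|f z' - f z| <= B * #|I|%:R * `|z' - z|.
Proof.
move=> b1 ccoef dec B0 h z z' hz hz'.
set N : R := #|I|%:R in hz hz' *; have N0 : 0 <= N by rewrite ler0n.
pose s := [seq (coef i (z' - z), b i) | i <- enum I].
have sumI (F : R * V -> R) : \sum_(cv <- s) F cv =
    \sum_i F (coef i (z' - z), b i) by rewrite big_map big_enum.
have S1 : \sum_(cv <- s) `|cv.1| <= N * `|z' - z|.
  rewrite sumI /=; apply: (@le_trans _ _ (\sum_(i : I) `|z' - z|)).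
    by apply: ler_sum => i _; exact: ccoef.
  by rewrite sumr_const mulr_natl.
have zz : `|z' - z| <= `|z' - z0| + `|z - z0|.
  by rewrite -(subrKA z0) (le_trans (ler_normD _ _))// (distrC z0).
have := @walk_bound R V f z0 r B s z.
rewrite {1}(_ : \sum_(cv <- s) cv.1 *: cv.2 = z' - z); last first.
  by rewrite big_map big_enum /= -dec.
rewrite (_ : z + (z' - z) = z'); last by rewrite addrC subrK.
move=> H; apply: (le_trans (H _ _ _)).
- by move=> y cv hy /mapP[i _ ->] /=; exact: h.
- by move=> cv /mapP[i _ ->] /=.
- apply: (le_lt_trans (lerD (lexx _) S1)).
  move: hz hz'; rewrite !ltr_pdivlMr; try lra.
  by move=> h1 h2; nra.
- by rewrite -mulrA ler_wpM2l.
Qed.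

Lemma C1_locally_lipschitz (R : realType) (m : nat) (g : 'rV[R]_m -> R)
    (x0 : 'rV[R]_m) :
  Ck 1 [set: 'rV[R]_m] g ->
  exists r M : R, [/\ 0 < r, 0 <= M & forall x y, `|x - x0| < r ->
    `|y - x0| < r -> `|g y - g x| <= M * `|y - x|].
Proof.
move=> [cg dg].
pose D i := 'D_(delta_mx 0 i : 'rV[R]_m) g.
have cD i : {for x0, continuous (D i)} by have [_ [+ _]] := dg (delta_mx 0 i); exact.
have [r r0 hr] : exists2 r : R, 0 < r & forall i y, `|y - x0| < r ->
    `|D i y| <= `|D i x0| + 1.
  have : \forall y \near x0, forall i : 'I_m, `|D i y| <= `|D i x0| + 1.
    apply: (@filter_forall _ 'I_m (fun i y => `|D i y| <= `|D i x0| + 1)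
      (nbhs x0) _) => i.
    have /cvgrPdist_lt /(_ _ ltr01) := cD i.
    apply: filterS => y hy; rewrite -[D i y](subrK (D i x0)) addrC.
    by rewrite (le_trans (ler_normD _ _))// lerD2l distrC ltW.
  move=> /nbhs_normP[r /= r0 hr]; exists r => // i y hy.
  by apply: hr; rewrite /= distrC.
pose B := \sum_i (`|D i x0| + 1).
have B0 : 0 <= B by apply: sumr_ge0 => i _; rewrite addr_ge0.
exists (r / (2 * #|'I_m|%:R + 1)), (B * #|'I_m|%:R); split.
- by rewrite divr_gt0// ltr_wpDl// mulr_ge0.
- by rewrite mulr_ge0.
- move=> x y; apply: (@lipschitz_of_basis _ _ _
    (fun i => delta_mx 0 i : 'rV[R]_m) (fun i z => z 0 i)) => //.
  + exact: norm_delta_le1.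
  + by move=> i z; exact: coord_le_norm.
  + exact: row_sum_delta.
  + move=> z i hz; split; first by have [+ _] := dg (delta_mx 0 i); exact.
    apply: (le_trans (hr i z hz)); rewrite /B (bigD1 i)//= lerDl.
    by apply: sumr_ge0 => j _; rewrite addr_ge0.
Qed.

Definition segment_in (R : realType) (V : normedModType R) (U : set V)
    (x y : V) : Prop :=
  forall t : R, 0 <= t <= 1 -> U (x + t *: (y - x)).

Lemma segment_ball (R : realType) (n : nat) (x y y' : 'rV[R]_n)
    (r t : R) : 0 <= t <= 1 -> `|y - x| < r -> `|y' - x| < r ->
  `|y + t *: (y' - y) - x| < r.
Proof.
move=> /andP[t0 t1] hy hy'.
have -> : y + t *: (y' - y) - x = (1 - t) *: (y - x) + t *: (y' - x).
  by apply/rowP => j; rewrite !mxE; ring.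
apply: (le_lt_trans (ler_normD _ _)).
rewrite !normrZ (ger0_norm t0) ger0_norm ?subr_ge0//.
pose m := Num.max `|y - x| `|y' - x|.
have mr : m < r by rewrite gt_max hy.
have h1 : (1 - t) * `|y - x| <= (1 - t) * m.
  by rewrite ler_wpM2l ?subr_ge0// le_max lexx.
have h2 : t * `|y' - x| <= t * m by rewrite ler_wpM2l// le_max lexx orbT.
lra.
Qed.

Lemma lipschitz_on_segment (R : realType) (V : normedModType R) (U : set V)
    (u : V -> R) (L : R) (x y : V) :
  (forall z, U z -> exists2 r : R, 0 < r & forall z', `|z' - z| < r ->
    `|u z' - u z| <= L * `|z' - z|) ->
  0 <= L -> segment_in U x y -> `|u y - u x| <= L * `|y - x|.
Proof.
move=> loc L0 seg; set D := `|y - x|.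
pose F t := u (x + t *: (y - x)).
have -> : u y - u x = F 1 - F 0.
  by rewrite /F scale1r scale0r addr0; congr (u _ - _); rewrite addrC subrK.
apply: slope_bound; last by rewrite mulr_ge0// /D.
move=> t t01 e e0; have [r r0 hr] := loc _ (seg t t01).
have D1 : 0 < D + 1 by rewrite ltr_wpDl// /D.
exists (r / (D + 1)); first exact: divr_gt0.
move=> s s01; rewrite ltr_pdivlMr// => st.
have dist : `|x + s *: (y - x) - (x + t *: (y - x))| = `|s - t| * D.
  by rewrite opprD addrACA subrr add0r -scalerBl normrZ.
have st0 := normr_ge0 (s - t).
have := hr (x + s *: (y - x)); rewrite dist => /(_ ltac:(lra)) h.
apply: (le_trans h); rewrite mulrCA mulrC ler_wpM2r// lerDl; exact: ltW.
Qed.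

(** Taylor-Young at order two, from the expansion of the first derivative at
    [x]: the remainder has slope at most [e h ^+ 2] along the segment. *)
Lemma taylor2 (R : realType) (V : normedModType R) (f : V -> R) (x v : V)
    (r e : R) : 0 < r -> (forall h : R, `|h| < r -> derivable f (x + h *: v) v) ->
  derivable ('D_v f) x v -> 0 < e ->
  exists2 d : R, 0 < d & forall h : R, `|h| < d ->
    `|f (x + h *: v) - f x - h * 'D_v f x - h ^+ 2 / 2 * 'D_v ('D_v f) x|
      <= e * h ^+ 2.
Proof.
move=> r0 df ddf e0; have [d d0 hd] := derive_expand ddf e0.
exists (Num.min r d); first by rewrite lt_min r0.
move=> h; rewrite lt_min => /andP[hr hhd].
set A := 'D_v f x; set B := 'D_v ('D_v f) x in hd *.
pose F s := f (x + (s * h) *: v) - s * h * A - (s * h) ^+ 2 / 2 * B.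
have -> : f (x + h *: v) - f x - h * A - h ^+ 2 / 2 * B = F 1 - F 0.
  by rewrite /F !mul1r !mul0r scale0r addr0; ring.
apply: slope_bound; last by rewrite mulr_ge0 ?sqr_ge0// ltW.
move=> t t01 k k0; have /andP[t0 t1] := t01.
have th : `|t * h| <= `|h|.
  by rewrite normrM ger0_norm// ler_piMl.
have [d1 d10 hd1] := derive_expand (df _ (le_lt_trans th hr))
  (divr_gt0 (divr_gt0 k0 (ltr0Sn _ 1)) (ltr_wpDl (normr_ge0 h) ltr01)).
set y := x + (t * h) *: v in hd1.
have h1 : 0 < `|h| + 1 by rewrite ltr_wpDl.
have hB : 0 < h ^+ 2 * `|B| + 1 by rewrite ltr_wpDl// mulr_ge0// sqr_ge0.
exists (Num.min (d1 / (`|h| + 1)) (k / (h ^+ 2 * `|B| + 1))).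
  by rewrite lt_min !divr_gt0.
move=> s s01; rewrite lt_min => /andP[]; rewrite !ltr_pdivlMr// => st1 st2.
set D := s - t in st1 st2 *; have D0 := normr_ge0 D.
have fs : f (x + (s * h) *: v) = f (y + (D * h) *: v).
  by rewrite /y -addrA -scalerDl; congr (f (x + _ *: v)); rewrite /D; ring.
have Dh : `|D * h| < d1 by rewrite normrM; lra.
have := hd1 _ Dh; set m := 'D_v f y => i1.
have := hd _ (le_lt_trans th hhd); rewrite -/y -/m -/A => i2.
have -> : F s - F t = (f (y + (D * h) *: v) - f y - D * h * m)
    + (D * h) * (m - A - t * h * B) - D ^+ 2 * h ^+ 2 * B / 2.
  by rewrite /F fs -/y /D; field.
have j2 : `|(D * h) * (m - A - t * h * B)| <= e * h ^+ 2 * `|D|.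
  rewrite normrM; apply: (@le_trans _ _ (`|D * h| * (e * `|h|))).
    by rewrite ler_wpM2l// (le_trans i2)// ler_wpM2l// ltW.
  by rewrite normrM -[h ^+ 2]real_normK ?num_real// expr2; lra.
have j1 : `|f (y + (D * h) *: v) - f y - D * h * m| <= k / 2 * `|D|.
  apply: (le_trans i1); rewrite normrM.
  have -> : k / 2 / (`|h| + 1) * (`|D| * `|h|) =
     k / 2 * `|D| * (`|h| / (`|h| + 1)) by ring.
  rewrite -[leRHS]mulr1 ler_wpM2l ?mulr_ge0//; first lra.
  by rewrite ler_pdivrMr// mul1r lerDl.
have j3 : `|D ^+ 2 * h ^+ 2 * B / 2| <= k / 2 * `|D|.
  have hh : h ^+ 2 = `|h| * `|h| by rewrite -expr2 real_normK ?num_real.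
  rewrite !normrM (@ger0_norm _ 2^-1)//.
  have : `|D| * (`|D| * (h ^+ 2 * `|B| + 1)) <= `|D| * k.
    by rewrite ler_wpM2l// ltW.
  have : 0 <= `|D| * `|D| by rewrite mulr_ge0.
  by rewrite hh; lra.
apply: (le_trans (ler_normB _ _)).
have := ler_normD (f (y + (D * h) *: v) - f y - D * h * m)
  ((D * h) * (m - A - t * h * B)).
lra.
Qed.

(** * Interior cones *)

(** The translates of a ball along an axis [e] form a cone with vertex [z]; one
    axis serves all the points of the closure near [x], and [s] measures at once
    the height, the aperture and the range of validity. *)
Definition cone_at (R : realType) (n : nat) (U : set 'rV[R]_n) (s : R)
    (x : 'rV[R]_n) : Prop :=
  exists2 e : 'rV[R]_n, `|e| <= s^-1 &
    forall (z w : 'rV[R]_n) (t : R), closure U z -> `|z - x| < s ->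
      0 < t -> t < s -> `|w| <= 1 -> U (z + t *: (e + w)).

Lemma cone_at_interior (R : realType) (n : nat) (U : set 'rV[R]_n)
    (x : 'rV[R]_n) :
  open U -> U x -> exists2 s : R, 0 < s & cone_at U s x.
Proof.
move=> oU Ux; have /nbhs_normP[r /= r0 hr] := open_nbhs_nbhs (conj oU Ux).
exists (r / 2); first by rewrite divr_gt0.
exists 0; first by rewrite normr0 invr_ge0 divr_ge0// ltW.
move=> z w t _ zx t0 tr w1; apply: hr; rewrite /= add0r distrC addrAC.
rewrite (le_lt_trans (ler_normD _ _))// normrZ gtr0_norm//.
have : t * `|w| <= t by rewrite -[leRHS]mulr1 ler_wpM2l// ltW.
lra.
Qed.

(** Above the graph of an M-Lipschitz function lies a vertical cone whose axis
    is longer than M times its radius.  A boundary point is handled through a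
    nearby point of the domain, at the price of doubling the radius. *)
Lemma cone_at_boundary (R : realType) (n : nat) (U : set 'rV[R]_n)
    (x : 'rV[R]_n) :
  smooth_boundary U -> bdry U x -> exists2 s : R, 0 < s & cone_at U s x.
Proof.
move=> sU /sU[r [i [b [g [r0 sg hg]]]]].
have [rho [M [rho0 M0 hM]]] := C1_locally_lipschitz (col' i x) (sg 1%N).
pose k := Num.min rho (r / (n%:R + 1)).
have n1 : 0 < n%:R + 1 :> R by rewrite ltr_wpDl.
have k0 : 0 < k by rewrite lt_min rho0 divr_gt0.
have kr v : `|v| < k -> enorm (v : 'rV[R]_n) < r.
  rewrite lt_min => /andP[_]; rewrite ltr_pdivlMr// => vr.
  apply: le_lt_trans (enorm_le_norm v) _; apply: le_lt_trans vr.
  by rewrite mulrC ler_wpM2l// lerDl.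
have colB (y y' : 'rV[R]_n) : `|col' i y - col' i y'| <= `|y - y'|.
  apply: norm_le_coord => // j; rewrite !mxE.
  by have := coord_le_norm (y - y') (lift i j); rewrite !mxE.
have krho v : `|v - x| < k -> `|col' i v - col' i x| < rho.
  by rewrite lt_min => /andP[+ _]; exact: le_lt_trans.
(* all the points used below are then within [k] of [x] *)
pose s := k / (2 * M + 7).
have M7 : 0 < 2 * M + 7 by lra.
(* [w'] below has size at most 2: over time [t] the graph rises by at most
   [2 M t] and [w'] lowers the point by at most [2 t], less than [(2 M + 3) t] *)
pose e : 'rV[R]_n := ((-1) ^+ b * (2 * M + 3)) *: delta_mx 0 i.
have ei : e 0 i = (-1) ^+ b * (2 * M + 3) by rewrite !mxE !eqxx mulr1.
have ej j : e 0 (lift i j) = 0.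
  by rewrite !mxE eqxx (eq_sym _ i) (negPf (neq_lift i j)) mulr0.
have eE : `|e| <= 2 * M + 3.
  rewrite normrZ normrM normrX normrN1 expr1n mul1r ger0_norm; last by lra.
  by rewrite -[leRHS]mulr1 ler_wpM2l ?norm_delta_le1//; lra.
pose s' := Num.min s (2 * M + 3)^-1.
have M3 : 0 < 2 * M + 3 by lra.
have s0 : 0 < s' by rewrite lt_min divr_gt0//= invr_gt0.
exists s' => //; exists e.
  apply: (le_trans eE); rewrite -[leLHS]invrK lef_pV2 ?posrE ?invr_gt0//.
  by rewrite ge_min lexx orbT.
move=> z w t cz; rewrite lt_min => /andP[zx _] t0.
rewrite lt_min => /andP[ts _] w1.
have sk : s * (2 * M + 7) = k by rewrite /s divfK// gt_eqF.
have [z' Uz' zz'] := closure_approx cz t0.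
pose w' := w + t^-1 *: (z - z').
have w'2 : `|w'| <= 2.
  rewrite (le_trans (ler_normD _ _))// normrZ gtr0_norm ?invr_gt0//.
  have : t^-1 * `|z - z'| <= 1 by rewrite mulrC ler_pdivrMr// mul1r ltW.
  lra.
have -> : z + t *: (e + w) = z' + t *: (e + w').
  by rewrite /w'; apply/rowP => j; rewrite !mxE; field; rewrite gt_eqF.
set y := z' + _.
have z'x : `|z' - x| < 2 * s.
  rewrite -(subrKA z) (le_lt_trans (ler_normD _ _))// (distrC z'); lra.
have yz' : `|y - z'| <= t * (2 * M + 5).
  rewrite /y addrAC subrr add0r normrZ gtr0_norm// ler_wpM2l ?(ltW t0)//.
  by rewrite (le_trans (ler_normD _ _))//; lra.
have yx : `|y - x| < k.
  rewrite -(subrKA z') (le_lt_trans (ler_normD _ _))//.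
  have : t * (2 * M + 5) <= s * (2 * M + 5) by rewrite ler_wpM2r ?(ltW ts)//; lra.
  rewrite -sk; lra.
have z'xk : `|z' - x| < k by rewrite -sk; apply: (lt_le_trans z'x); nra.
apply/hg; first exact: kr.
have /hg gz' := Uz'; have {gz'} gz' := gz' (kr _ z'xk).
have cyz : `|col' i y - col' i z'| <= t * 2.
  apply: norm_le_coord => [|j]; first by rewrite mulr_ge0// ltW.
  have -> : (col' i y - col' i z') 0 j = t * w' 0 (lift i j).
    by rewrite /y; have := ej j; rewrite !mxE => ->; ring.
  rewrite normrM gtr0_norm// ler_wpM2l ?(ltW t0)//.
  exact: le_trans (coord_le_norm _ _) w'2.
have := hM _ _ (krho _ z'xk) (krho _ yx) => hMyz.
have {hMyz} gy : g (col' i y) <= g (col' i z') + M * (t * 2).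
  rewrite -lerBlDl (le_trans (ler_norm _))// (le_trans hMyz)//.
  exact: ler_wpM2l.
have yi : (-1) ^+ b * y 0 i = (-1) ^+ b * z' 0 i + t * (2 * M + 3)
    + t * ((-1) ^+ b * w' 0 i).
  have -> : y 0 i = z' 0 i + t * (e 0 i + w' 0 i) by rewrite /y !mxE.
  have bb : (-1) ^+ b * (-1) ^+ b = 1 :> R by rewrite -signr_addb addbb.
  rewrite ei; move: ((-1) ^+ b) bb => sg1 bb.
  rewrite -[X in _ = _ + X + _]mul1r -bb; ring.
have wi : - 2 <= (-1) ^+ b * w' 0 i.
  have : `|(-1) ^+ b * w' 0 i| <= 2.
    rewrite normrM normrX normrN1 expr1n mul1r.
    exact: le_trans (coord_le_norm _ _) w'2.
  by rewrite ler_norml => /andP[].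
have : t * (- 2) <= t * ((-1) ^+ b * w' 0 i) by rewrite ler_wpM2l// ltW.
rewrite yi; nra.
Qed.

Lemma cone_at_shrink (R : realType) (n : nat) (U : set 'rV[R]_n) (s s' : R)
    (x x' : 'rV[R]_n) :
  0 < s' -> s' <= s / 2 -> `|x' - x| < s / 2 -> cone_at U s x ->
  cone_at U s' x'.
Proof.
move=> s'0 ss' xx' [e eE h]; exists e.
  by rewrite (le_trans eE)// lef_pV2 ?posrE//; lra.
move=> z w t cz zx' t0 ts' w1; apply: h => //; last by lra.
by rewrite -(subrKA x') (le_lt_trans (ler_normD _ _))//; lra.
Qed.

Lemma uniform_cone (R : realType) (n : nat) (U : set 'rV[R]_n) :
  smooth_bounded_domain U ->
  exists2 s : R, 0 < s <= 1 & forall x, closure U x -> cone_at U s x.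
Proof.
move=> [oU _ _ bU sU].
have loc : forall x, closure U x -> exists2 s : R, 0 < s & cone_at U s x.
  move=> x cx; have [Ux|nUx] := pselect (U x); first exact: cone_at_interior.
  by apply: cone_at_boundary => //; split => // /interior_subset.
have /compact_near_coveringP cover := compact_closure_bounded bU.
have near_cone : \forall s \near 0^'+, closure U `<=` cone_at U s.
  apply: cover => x /loc[s s0 hs].
  exists (ball x (s / 2), [set s' | 0 < s' <= s / 2]) => /=.
    split; first exact: (nbhsx_ballx x (s / 2) (divr_gt0 s0 (ltr0Sn _ 1))).
    near=> s'; apply/andP; split; near: s'; first exact: nbhs_right_gt.
    by apply: nbhs_right_le; rewrite divr_gt0.
  move=> [x' s'] /= [xx' /andP[s'0 ss']].
  apply: cone_at_shrink hs => //.
  by move: xx'; rewrite -ball_normE /= distrC.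
have [s [[s0 s1] hs]] : exists s : R, (0 < s /\ s <= 1) /\ closure U `<=` cone_at U s.
  apply: (@filter_ex _ (0 : R)^'+); near=> s; split; last by near: s.
  split; near: s; first exact: nbhs_right_gt.
  by apply: nbhs_right_le.
by exists s => //; rewrite s0.
Unshelve. all: by end_near.
Qed.

(** * Lipschitz bounds from contact slopes *)

(** Sup-convolution: the maximum over [x] of [u x - a |x - y|^2] is attained at a
    point where [u] is touched from above by a paraboloid, whose slope is at most
    [G]; hence this maximum, as a function of [y], has slopes at most [n G].  It
    tends to [u] as [a] grows, and the bound survives.  Quadratic penalties keep
    all test functions smooth, unlike a comparison with cones. *)
Lemma locally_lipschitz_of_slopes (R : realType) (n : nat) (U : set 'rV[R]_n)
    (u : 'rV[R]_n -> R) (G : R) (x : 'rV[R]_n) :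
  open U -> compact (closure U) -> {within closure U, continuous u} ->
  (forall x0 p a, U x0 ->
    (forall z, closure U z ->
      u z <= u x0 + dotv p (z - x0) + a * dotv (z - x0) (z - x0)) ->
    `|p| <= G) ->
  0 <= G -> U x -> exists2 r : R, 0 < r & forall y y', `|y - x| < r ->
    `|y' - x| < r -> `|u y' - u y| <= n%:R * G * `|y' - y|.
Proof.
move=> oU cU cu hG G0 Ux.
have K0 : closure U !=set0 by exists x; exact: subset_closure.
have [r r0 hr] := ball_in_open oU Ux.
have [M M0 hM] : exists2 M : R, 0 <= M & forall z, closure U z -> `|u z| <= M.
  exact: compact_continuous_bounded.
pose rho := r / 2; have rho0 : 0 < rho by rewrite divr_gt0.
exists rho => // y y' hy hy'.
suff one z z' : `|z - x| < rho -> `|z' - x| < rho ->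
    u z' - u z <= n%:R * G * `|z' - z|.
  by rewrite ler_norml lerNl opprB [in X in X && _]distrC !one.
move=> {y y' hy hy'} hy hy'.
have inU v : `|v - x| < rho -> U v.
  by move=> vx; apply: hr; rewrite /rho in vx; lra.
have inK v : `|v - x| < rho -> closure U v by move/inU; exact: subset_closure.
apply/ler_addgt0Pr => k k0.
have [d d0 hd] := (within_continuousP _ _).1 cu z (inK _ hy) k k0.
pose c := Num.min rho d; have c0 : 0 < c by rewrite lt_min rho0.
(* [a c ^ 2] exceeds the oscillation of [u], so that a maximum point of
   [u w - a |w - v|^2] is within [c] of [v] *)
pose a := (2 * M + 1) / c ^+ 2.
have c20 : 0 < c ^+ 2 by rewrite exprn_gt0.
have a0 : 0 < a by rewrite divr_gt0//; lra.
have ac : a * c ^+ 2 = 2 * M + 1 by rewrite /a divfK// gt_eqF.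
have max_ex v : exists x0, closure U x0 /\ forall w, closure U w ->
    u w - a * dotv (w - v) (w - v) <= u x0 - a * dotv (x0 - v) (x0 - v).
  have cf : {within closure U, continuous (fun w => u w - a * dotv (w - v) (w - v))}.
    apply/subspace_continuousP => w cw; apply: cvgB.
      by move/subspace_continuousP: cu; exact.
    apply: cvgMr; apply: cvg_dotv.
      by apply: cvgB; [exact: cvg_within | exact: cvg_cst].
    by apply: cvgB; [exact: cvg_within | exact: cvg_cst].
  have [b bK hb] := compact_EVT_max K0 cU cf.
  exists b; split; first by rewrite inE in bK.
  by move=> w cw; apply: hb; rewrite inE.
have [m hm] := choice max_ex.
pose S v := u (m v) - a * dotv (m v - v) (m v - v).
have near_m v : `|v - x| < rho -> `|m v - v| < c.
  move=> vx; have [mK hmv] := hm v; have := hmv v (inK _ vx).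
  rewrite subrr dotv0l mulr0 subr0.
  move=> h; rewrite ltNge; apply/negP => cm.
  have h1 : c ^+ 2 <= dotv (m v - v) (m v - v).
    by apply: le_trans (norm_le_dotv _); rewrite ler_pXn2r ?nnegrE// ltW.
  have h2 : a * c ^+ 2 <= a * dotv (m v - v) (m v - v) by rewrite ler_wpM2l ?(ltW a0).
  have := hM _ mK; have := hM _ (inK _ vx); rewrite !ler_norml.
  move=> /andP[h3 h4] /andP[h5 h6]; lra.
have slope v : `|v - x| < rho -> `|(2 * a) *: (m v - v)| <= G.
  move=> vx; have [mK hmv] := hm v; apply: (hG (m v) _ a).
    apply: hr; rewrite -(subrKA v) (le_lt_trans (ler_normD _ _))//.
    have : c <= rho by rewrite ge_min lexx.
    have := near_m _ vx; rewrite /rho in vx *; lra.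
  move=> w cw; have := hmv w cw.
  have -> : w - v = (m v - v) + (w - m v) by rewrite [RHS]addrC subrKA.
  rewrite dotv_sqrD dotvZl; lra.
have incr v v' : `|v - x| < rho -> `|v' - x| < rho ->
    S v - S v' <= n%:R * G * `|v' - v| + a * n%:R * `|v' - v| ^+ 2.
  move=> vx v'x; have [mK hmv] := hm v; have [_ hmv'] := hm v'.
  have := hmv' _ mK; rewrite -/(S v') -(subrKA v (m v)) dotv_sqrD => h.
  have h1 : 2 * a * dotv (m v - v) (v - v') <= n%:R * G * `|v' - v|.
    rewrite -dotvZl (le_trans (ler_norm _))// (le_trans (dotv_le_norm _ _))//.
    by rewrite (distrC v) ler_wpM2r// ler_wpM2l// slope.
  have h2 : a * dotv (v - v') (v - v') <= a * n%:R * `|v' - v| ^+ 2.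
    rewrite -mulrA ler_wpM2l ?(ltW a0)// (le_trans (ler_norm _))//.
    by rewrite (le_trans (dotv_le_norm _ _))// (distrC v) -mulrA.
  rewrite {1}/S; lra.
have S_lip : `|S z' - S z| <= n%:R * G * `|z' - z|.
  set D := `|z' - z|.
  pose F t := S (z + t *: (z' - z)).
  have -> : S z' - S z = F 1 - F 0.
    by rewrite /F scale1r scale0r addr0; congr (S _ - _); rewrite addrC subrK.
  apply: slope_bound; last by rewrite /D !mulr_ge0.
  move=> t t01 e e0.
  have aD : 0 < a * n%:R * D ^+ 2 + 1.
    apply: ltr_wpDl => //; apply: mulr_ge0; last exact: sqr_ge0.
    by apply: mulr_ge0; [exact: ltW | exact: ler0n].
  exists (e / (a * n%:R * D ^+ 2 + 1)); first exact: divr_gt0.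
  move=> s s01; rewrite ltr_pdivlMr// => st.
  have hs := segment_ball s01 hy hy'; have ht := segment_ball t01 hy hy'.
  have dist : `|z + s *: (z' - z) - (z + t *: (z' - z))| = `|s - t| * D.
    by rewrite opprD addrACA subrr add0r -scalerBl normrZ.
  have bound : n%:R * G * (`|s - t| * D) + a * n%:R * (`|s - t| * D) ^+ 2
      <= (n%:R * G * D + e) * `|s - t|.
    have -> : n%:R * G * (`|s - t| * D) + a * n%:R * (`|s - t| * D) ^+ 2 =
      (n%:R * G * D + `|s - t| * (a * n%:R * D ^+ 2)) * `|s - t| by ring.
    rewrite ler_wpM2r// lerD2l; have := normr_ge0 (s - t); lra.
  have i1 := incr _ _ hs ht; have i2 := incr _ _ ht hs.
  rewrite (distrC (z + t *: _)) dist in i1; rewrite dist in i2.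
  rewrite ler_norml; apply/andP; split; rewrite /F; lra.
have uS v : `|v - x| < rho -> u v <= S v.
  move=> vx; have [_ /(_ v (inK _ vx))] := hm v.
  by rewrite subrr dotv0l mulr0 subr0.
have Su : S z <= u z + k.
  have [mK _] := hm z.
  have : `|u z - u (m z)| < k.
    apply: hd => //; rewrite distrC; apply: lt_le_trans (near_m _ hy) _.
    by rewrite ge_min lexx orbT.
  rewrite ltr_norml => /andP[h _]; rewrite /S.
  have : 0 <= a * dotv (m z - z) (m z - z) by rewrite mulr_ge0 ?dotv_ge0// ltW.
  lra.
have := uS _ hy'; move: S_lip; rewrite ler_norml => /andP[_]; lra.
Qed.

(** Any two nearby points of the closure can be pushed inside along a common
    cone axis, by their distance, and joined there by a segment of the domain. *)
Lemma lipschitz_on_closure (R : realType) (n : nat) (U : set 'rV[R]_n) (s : R)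
    (u : 'rV[R]_n -> R) (L : R) :
  compact (closure U) -> {within closure U, continuous u} -> 0 < s ->
  (forall x, closure U x -> cone_at U s x) -> 0 <= L ->
  (forall x y, segment_in U x y -> `|u y - u x| <= L * `|y - x|) ->
  exists2 L' : R, 0 <= L' & forall x y, closure U x -> closure U y ->
    `|u y - u x| <= L' * `|y - x|.
Proof.
move=> cU cu s0 cone L0 hseg.
have [M M0 hM] := compact_continuous_bounded cU cu.
have si0 : 0 < s^-1 by rewrite invr_gt0.
have Ms0 : 0 <= 2 * M / s by rewrite mulr_ge0 ?mulr_ge0// ltW.
have Ls0 : 0 <= L * s^-1 by rewrite mulr_ge0// ltW.
exists (2 * M / s + L + 2 * (L * s^-1)); first lra.
move=> x y cx cy; set d := `|y - x|.
have d0 : 0 <= d by rewrite /d.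
have [ds|sd] := ltP d s; last first.
  have h1 : 2 * M <= 2 * M / s * d.
    by rewrite -[leLHS](divfK (lt0r_neq0 s0)) ler_wpM2l.
  have h2 : 0 <= (L + 2 * (L * s^-1)) * d by rewrite mulr_ge0//; lra.
  have := hM _ cx; have := hM _ cy; rewrite !ler_norml.
  by move=> /andP[? ?] /andP[? ?]; apply/andP; split; lra.
have [d_eq0|dN0] := eqVneq d 0.
  have /eqP : `|y - x| = 0 by [].
  by rewrite normr_eq0 subr_eq0 => /eqP ->; rewrite subrr normr0 d_eq0 mulr0.
have {dN0}dgt0 : 0 < d by rewrite lt_neqAle eq_sym dN0.
have [e eE hcone] := cone x cx.
have push z : closure U z -> `|z - x| < s ->
    `|u (z + d *: e) - u z| <= L * s^-1 * d.
  move=> cz zx; apply/ler_addgt0Pr => k k0.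
  have [d1 d10 hd1] := (within_continuousP _ _).1 cu z cz k k0.
  have e1 : 0 < `|e| + 1 by rewrite ltr_wpDl.
  pose h := Num.min d (d1 / (`|e| + 1)).
  have h0 : 0 < h by rewrite lt_min dgt0 divr_gt0.
  have hd : h <= d by rewrite ge_min lexx.
  have he : h * `|e| < d1.
    have : h * (`|e| + 1) <= d1 by rewrite -ler_pdivlMr// ge_min lexx orbT.
    lra.
  have inU t : 0 < t -> t <= d -> U (z + t *: e).
    move=> t0 td; rewrite -[e]addr0; apply: hcone; rewrite ?normr0//.
    exact: le_lt_trans ds.
  have i1 : `|u z - u (z + h *: e)| < k.
    apply: hd1; first exact/subset_closure/inU.
    by rewrite opprD addNKr normrN normrZ gtr0_norm.
  have i2 : `|u (z + d *: e) - u (z + h *: e)| <= L * s^-1 * d.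
    apply: (le_trans (hseg _ _ _)).
      move=> t /andP[t0 t1].
      have -> : z + h *: e + t *: (z + d *: e - (z + h *: e)) =
          z + (h + t * (d - h)) *: e.
        by apply/rowP => j; rewrite !mxE; ring.
      by apply: inU; nra.
    rewrite opprD addrACA subrr add0r -scalerBl normrZ ger0_norm ?subr_ge0//.
    rewrite -mulrA ler_wpM2l// mulrC.
    by apply: ler_pM => //; [rewrite subr_ge0 | rewrite gerBl ltW].
  have -> : u (z + d *: e) - u z = (u (z + d *: e) - u (z + h *: e))
     - (u z - u (z + h *: e)) by ring.
  by rewrite (le_trans (ler_normB _ _))// lerD// ltW.
have px := push x cx _; have py := push y cy ds.
have {}px : `|u (x + d *: e) - u x| <= L * s^-1 * d.
  by apply: px; rewrite subrr normr0.
have pxy : `|u (y + d *: e) - u (x + d *: e)| <= L * d.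
  have -> : L * d = L * `|y + d *: e - (x + d *: e)|.
    by rewrite opprD addrACA subrr addr0.
  apply: hseg => t /andP[t0 t1].
  have -> : x + d *: e + t *: (y + d *: e - (x + d *: e)) =
      x + d *: (e + (t / d) *: (y - x)).
    by apply/rowP => j; rewrite !mxE; field; rewrite gt_eqF.
  apply: hcone => //; first by rewrite subrr normr0.
  rewrite normrZ -/d ger0_norm ?divr_ge0 ?(ltW dgt0)// divfK ?gt_eqF//.
have Md0 : 0 <= 2 * M / s * d by rewrite mulr_ge0.
move: px py pxy; rewrite !ler_norml => /andP[? ?] /andP[? ?] /andP[? ?].
by apply/andP; split; lra.
Qed.

(** * Testing the equations with paraboloids *)

(** Contact from above with a paraboloid of opening [a] is a test that first and
    second order equations share: [nu] is 0 for a viscosity solution, and 2 n eps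
    for a solution with viscosity eps, whose Laplacian is at most 2 n a at the
    contact point. *)
Definition paraboloid_subsol (R : realType) (n : nat) (U : set 'rV[R]_n)
    (nu c d : R) (H : 'rV[R]_n -> 'rV[R]_n -> R) (u w : 'rV[R]_n -> R) : Prop :=
  forall (x0 p : 'rV[R]_n) (a : R), U x0 ->
    (forall z, closure U z ->
      u z <= u x0 + dotv p (z - x0) + a * dotv (z - x0) (z - x0)) ->
    c * u x0 + d * w x0 + H x0 p <= nu * a.

(** The Hamiltonian of the equation solved by the opposite of a solution. *)
Definition reflectH (R : realType) (n : nat) (H : 'rV[R]_n -> 'rV[R]_n -> R)
    (x p : 'rV[R]_n) : R := - H x (- p).

Lemma derive_of_expansion (R : realType) (V : normedModType R) (f : V -> R)
    (x v : V) (A B : R) :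
  (forall h : R, f (h *: v + x) = f x + h * A + h ^+ 2 * B) ->
  is_derive x v f A.
Proof.
move=> hf; have lim : h^-1 *: ((f \o shift x) (h *: v) - f x) @[h --> 0^'] --> A.
  have : A + h * B @[h --> (0 : R)^'] --> A.
    rewrite -[X in _ --> X]addr0 -[X in _ + X](mul0r B).
    apply: cvgD; first exact: cvg_cst.
    by apply: cvgMl; exact: cvg_within.
  apply: cvg_trans; apply: near_eq_cvg.
  near=> h; have h0 : h != 0 by near: h; exact: nbhs_dnbhs_neq.
  rewrite /= hf /GRing.scale /=; field; exact: h0.
by apply: DeriveDef; [apply/cvg_ex; exists A | exact: cvg_lim].
Unshelve. all: by end_near.
Qed.

Lemma Ck1_paraboloid (R : realType) (n : nat) (U : set 'rV[R]_n)
    (x0 p : 'rV[R]_n) (a : R) :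
  let phi := fun z => dotv p (z - x0) + a * dotv (z - x0) (z - x0) in
  Ck 1 U phi /\ grad phi x0 = p.
Proof.
move=> phi.
have der x v : is_derive x v phi (dotv p v + 2 * a * dotv (x - x0) v).
  apply: (@derive_of_expansion _ _ _ _ _ _ (a * dotv v v)) => h.
  rewrite /phi; have -> : h *: v + x - x0 = (x - x0) + h *: v by rewrite -addrA addrC.
  by rewrite dotv_sqrD dotvDr !(dotvZr, dotvZl); ring.
have cvg_par (F : set_system 'rV[R]_n) (x : 'rV[R]_n) : Filter F ->
    z @[z --> F] --> x -> phi z @[z --> F] --> phi x /\
    forall (b c : R) q, b + c * dotv (z - x0) q @[z --> F] --> b + c * dotv (x - x0) q.
  move=> FF Fx; have Fx0 : z - x0 @[z --> F] --> x - x0.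
    by apply: cvgB => //; exact: cvg_cst.
  split=> [|b c q]; apply: cvgD.
  - by apply: cvg_dotv => //; exact: cvg_cst.
  - by apply: cvgMr; exact: cvg_dotv.
  - exact: cvg_cst.
  - by apply: cvgMr; apply: cvg_dotv => //; exact: cvg_cst.
split; last first.
  apply/rowP => i; rewrite mxE /partial; have [_ ->] := der x0 (delta_mx 0 i).
  by rewrite subrr dotv0l mulr0 addr0 dotv_delta.
split=> [x _|v]; first exact: (cvg_par (nbhs x) x _ cvg_id).1.
split; first by move=> x _; have [] := der x v.
split=> // x _; have -> : 'D_v phi = fun x => dotv p v + 2 * a * dotv (x - x0) v.
  by apply/funext => y; have [_ ->] := der y v.
exact: (cvg_par (nbhs x) x _ cvg_id).2.
Qed.

Lemma visc_sol_paraboloid (R : realType) (n : nat) (U : set 'rV[R]_n)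
    (c d : R) (H : 'rV[R]_n -> 'rV[R]_n -> R) (u w : 'rV[R]_n -> R) :
  open U -> visc_sol U (fun x r p => c * r + d * w x + H x p) u ->
  paraboloid_subsol U 0 c d H u w /\
  paraboloid_subsol U 0 c d (reflectH H) (\- u) (\- w).
Proof.
move=> oU [sub sup].
have near_closure x0 (P : 'rV[R]_n -> Prop) : U x0 -> (forall z, closure U z -> P z) ->
    \forall z \near x0, P z.
  move=> Ux0 hP; apply: (filterS _ (open_nbhs_nbhs (conj oU Ux0))).
  by move=> z Uz; apply: hP; exact: subset_closure.
split=> x0 p a Ux0 touch; rewrite mul0r.
  have [ck g] := Ck1_paraboloid U x0 p a.
  have := sub _ x0 ck Ux0; rewrite g; apply.
  apply: near_closure => // z cz.
  by have := touch z cz; rewrite subrr dotv0r dotv0l mulr0; lra.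
have [ck g] := Ck1_paraboloid U x0 (- p) (- a).
have := sup _ x0 ck Ux0; rewrite g /reflectH => h.
suff : 0 <= c * u x0 + d * w x0 + H x0 (- p) by rewrite /=; lra.
apply: h; apply: near_closure => // z cz.
have /= := touch z cz.
by rewrite subrr dotv0r dotv0l mulr0 dotvNl /=; lra.
Qed.

(** At a contact point the equation bounds [H x0 p] by the size of the zeroth
    order terms, which excludes large [p] for a superlinear [H]. *)
Lemma slope_of_coercive (R : realType) (n : nat) (U : set 'rV[R]_n)
    (c d : R) (H : 'rV[R]_n -> 'rV[R]_n -> R) (u w : 'rV[R]_n -> R) (M : R) :
  unif_pinfty (closure U) (fun x p => H x p / enorm p) ->
  (forall z, closure U z -> `|u z| <= M /\ `|w z| <= M) ->
  paraboloid_subsol U 0 c d H u w ->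
  exists2 G : R, 0 <= G & forall x0 p a, U x0 ->
    (forall z, closure U z ->
      u z <= u x0 + dotv p (z - x0) + a * dotv (z - x0) (z - x0)) ->
    `|p| <= G.
Proof.
move=> coer hM sub.
pose N := `|c| * M + `|d| * M.
have [r hr] := coer (Num.max 0 N + 1).
exists (Num.max r 1); first by rewrite le_max ler01 orbT.
move=> x0 p a Ux0 touch; apply: (le_trans (norm_le_enorm p)).
rewrite leNgt; apply/negP; rewrite gt_max => /andP[rp p1].
have cx0 := subset_closure Ux0.
have := hr _ _ cx0 (ltW rp); have p0 : 0 < enorm p := lt_trans ltr01 p1.
rewrite ler_pdivlMr// => h1.
have := sub _ _ _ Ux0 touch; rewrite mul0r => h2.
have [hu hw] := hM _ cx0.
have h3 : - (c * u x0 + d * w x0) <= N.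
  rewrite (le_trans (ler_norm _))// normrN (le_trans (ler_normD _ _))//.
  by rewrite !normrM lerD// ler_wpM2l.
have m0 : 0 <= Num.max 0 N by rewrite le_max lexx.
have mN : N <= Num.max 0 N by rewrite le_max lexx orbT.
have : Num.max 0 N + 1 <= (Num.max 0 N + 1) * enorm p.
  by rewrite -[leLHS]mulr1 ler_wpM2l ?(ltW p1)//; lra.
lra.
Qed.

(** Dividing by [h] of either sign gives the slope, then dividing by [h ^+ 2]
    gives the curvature.  The expansion is a hypothesis on [A] and [B] so that
    the lemma applies to a function and to its opposite alike. *)
Lemma parabola_contact (R : realType) (g : R -> R) (A B p a r : R) :
  (forall e : R, 0 < e -> exists2 d : R, 0 < d & forall h : R, `|h| < d ->
    `|g h - g 0 - h * A - h ^+ 2 / 2 * B| <= e * h ^+ 2) ->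
  0 < r -> (forall h : R, `|h| < r -> g h <= g 0 + p * h + a * h ^+ 2) ->
  A = p /\ B <= 2 * a.
Proof.
move=> tay r0 touch.
have key (e : R) : 0 < e -> exists2 d : R, 0 < d & forall h : R, `|h| < d ->
    h * (A - p) + h ^+ 2 * (B / 2 - a - e) <= 0.
  move=> e0; have [d d0 hd] := tay e e0.
  exists (Num.min d r); first by rewrite lt_min d0.
  move=> h; rewrite lt_min => /andP[/hd + /touch].
  by rewrite ler_norml => /andP[]; lra.
have Ap : A = p.
  have [d d0 hd] := key 1 ltr01.
  set q := B / 2 - a - 1 in hd.
  have aux (s : R) : s ^+ 2 = 1 -> s * (A - p) <= 0.
    move=> s1; apply/ler_addgt0Pr => k k0; rewrite add0r.
    have q1 : 0 < `|q| + 1 by rewrite ltr_wpDl.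
    pose h := Num.min (d / 2) (k / (`|q| + 1)).
    have h0 : 0 < h by rewrite lt_min !divr_gt0.
    have hk : h * (`|q| + 1) <= k by rewrite -ler_pdivlMr// ge_min lexx orbT.
    have hd2 : h <= d / 2 by rewrite ge_min lexx.
    have sn : `|s| = 1.
      by apply/eqP; rewrite -(@eqrXn2 _ 2)// expr1n real_normK ?num_real// s1.
    have := hd (s * h); rewrite normrM sn mul1r gtr0_norm// => /(_ ltac:(lra)).
    rewrite exprMn s1 mul1r => hh.
    have : s * (A - p) + h * q <= 0.
      by rewrite -(pmulr_rle0 _ h0); lra.
    have : - (h * q) <= h * `|q|.
      by rewrite -mulrN ler_wpM2l ?(ltW h0)// -normrN ler_norm.
    lra.
  have h1 := aux 1 (expr1n _ _).
  have h2 : - 1 * (A - p) <= 0 by apply: aux; rewrite sqrrN expr1n.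
  lra.
split=> //; rewrite leNgt; apply/negP => lt.
have [d d0 hd] := key ((B / 2 - a) / 2) ltac:(lra).
have := hd (d / 2); rewrite gtr0_norm ?divr_gt0// => /(_ ltac:(lra)).
rewrite Ap subrr mulr0 add0r; apply/negP; rewrite -ltNge.
by apply: mulr_gt0; [rewrite exprn_gt0// divr_gt0 | lra].
Qed.

Lemma smooth_sol_paraboloid (R : realType) (n : nat) (U : set 'rV[R]_n)
    (c d eps : R) (H : 'rV[R]_n -> 'rV[R]_n -> R) (v w : 'rV[R]_n -> R) :
  open U -> smooth U v -> 0 <= eps ->
  (forall x, U x ->
    c * v x + d * w x + H x (grad v x) = eps * laplacian v x) ->
  paraboloid_subsol U (2 * n%:R * eps) c d H v w /\
  paraboloid_subsol U (2 * n%:R * eps) c d (reflectH H) (\- v) (\- w).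
Proof.
move=> oU sv eps0 pde.
have tay x0 i (e : R) : U x0 -> 0 < e ->
    exists2 d : R, 0 < d & forall h : R, `|h| < d ->
    `|v (x0 + h *: delta_mx 0 i) - v x0 - h * partial i v x0
      - h ^+ 2 / 2 * partial i (partial i v) x0| <= e * h ^+ 2.
  move=> Ux0 e0; have [r r0 hr] := ball_in_open oU Ux0.
  have [_ /(_ (delta_mx 0 i))[dv [_ /(_ (delta_mx 0 i))[ddv _]]]] := sv 2.
  apply: (taylor2 r0) => //; last exact: ddv.
  move=> h hh; apply/dv/hr; rewrite addrAC subrr add0r normrZ.
  by apply: le_lt_trans hh; rewrite -[leRHS]mulr1 ler_wpM2l// norm_delta_le1.
have line x0 i : U x0 -> exists2 r : R, 0 < r & forall h : R, `|h| < r ->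
    closure U (x0 + h *: delta_mx 0 i).
  move=> Ux0; have [r r0 hr] := ball_in_open oU Ux0; exists r => // h hh.
  apply/subset_closure/hr; rewrite addrAC subrr add0r normrZ.
  by apply: le_lt_trans hh; rewrite -[leRHS]mulr1 ler_wpM2l// norm_delta_le1.
have dd (i : 'I_n) : dotv (delta_mx 0 i) (delta_mx 0 i) = 1 :> R.
  by rewrite dotv_delta mxE !eqxx.
have sum_le (F : 'I_n -> R) (a : R) : (forall i, F i <= 2 * a) ->
    eps * \sum_i F i <= 2 * n%:R * eps * a.
  move=> hF; have -> : 2 * n%:R * eps * a = eps * (n%:R * (2 * a)) by ring.
  rewrite ler_wpM2l//.
  apply: (@le_trans _ _ (\sum_(i < n) 2 * a)); first exact: ler_sum.
  by rewrite sumr_const card_ord [n%:R * _]mulr_natl.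
split=> x0 p a Ux0 touch.
  have con i : partial i v x0 = p 0 i /\ partial i (partial i v) x0 <= 2 * a.
    have [r r0 hr] := line x0 i Ux0.
    apply: (@parabola_contact R (fun h => v (x0 + h *: delta_mx 0 i)) _ _ _ _ r) => //.
      by move=> e e0; rewrite scale0r addr0; exact: tay.
    move=> h hh; rewrite scale0r addr0; have := touch _ (hr h hh).
    rewrite (addrAC x0) subrr add0r !(dotvZl, dotvZr) dd dotv_delta; lra.
  have gp : grad v x0 = p by apply/rowP => i; rewrite mxE; case: (con i).
  have := pde _ Ux0; rewrite gp => ->.
  by apply: sum_le => i; case: (con i).
have con i : - partial i v x0 = p 0 i /\ - partial i (partial i v) x0 <= 2 * a.
  have [r r0 hr] := line x0 i Ux0.
  apply: (@parabola_contact R (fun h => - v (x0 + h *: delta_mx 0 i)) _ _ _ _ r) => //.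
    move=> e e0; rewrite scale0r addr0; have [dl d0 hd] := tay x0 i e Ux0 e0.
    exists dl => // h /hd; rewrite -normrN; congr (`|_| <= _); ring.
  move=> h hh; rewrite scale0r addr0; have := touch _ (hr h hh).
  rewrite (addrAC x0) subrr add0r !(dotvZl, dotvZr) dd dotv_delta /=; lra.
have gp : grad v x0 = - p.
  by apply/rowP => i; rewrite !mxE; case: (con i) => <- _; rewrite opprK.
have := pde _ Ux0; rewrite gp /reflectH => e1.
have : eps * \sum_i - partial i (partial i v) x0 <= 2 * n%:R * eps * a.
  by apply: sum_le => i; case: (con i).
rewrite sumrN mulrN -/(laplacian v x0) -e1 /=; lra.
Qed.

(** * Lipschitz bounds for the Hamiltonians *)

Lemma bounded_on_slab (R : realType) (n : nat) (U : set 'rV[R]_n)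
    (g : 'rV[R]_n * 'rV[R]_n -> R) (P : R) :
  compact (closure U) ->
  {within closure (U `*` [set: 'rV[R]_n]), continuous g} ->
  exists2 B : R, 0 <= B & forall x p, closure U x -> `|p| < P ->
    `|g (x, p)| <= B.
Proof.
move=> cU cg; pose K := [set p : 'rV[R]_n | `|p| < P].
have bK : bounded_set K.
  exists P; split; first exact: num_real.
  by move=> y Py p /ltW pP /=; exact: le_trans pP (ltW Py).
have cK := compact_setX cU (compact_closure_bounded bK).
have sub : closure U `*` closure K `<=` closure (U `*` [set: 'rV[R]_n]).
  move=> [x p] [/= cx _] A [[A1 A2] [/= n1 n2] sA].
  have [x' [Ux' Ax']] := cx A1 n1; exists (x', p); split; first by [].
  by apply: sA; split => //; exact: nbhs_singleton.
have [B B0 hB] := compact_continuous_bounded cK (continuous_subspaceW sub cg).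
by exists B => // x p cx pP; apply: hB; split => //; exact: subset_closure.
Qed.

Lemma prod_norm_le (R : realType) (n : nat) (z : 'rV[R]_n * 'rV[R]_n) :
  `|z| <= `|z.1| + `|z.2|.
Proof. by rewrite prod_normE ge_max lerDl lerDr !normr_ge0. Qed.

Lemma norm_components_le (R : realType) (n : nat) (z : 'rV[R]_n * 'rV[R]_n) :
  `|z.1| <= `|z| /\ `|z.2| <= `|z|.
Proof. by rewrite prod_normE !le_max !lexx orbT. Qed.

Definition prod_basis (R : realType) (n : nat) (i : 'I_n + 'I_n) :
    'rV[R]_n * 'rV[R]_n :=
  match i with
  | inl j => (delta_mx 0 j, 0)
  | inr j => (0, delta_mx 0 j)
  end.

Definition prod_coord (R : realType) (n : nat) (i : 'I_n + 'I_n)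
    (z : 'rV[R]_n * 'rV[R]_n) : R :=
  match i with inl j => z.1 0 j | inr j => z.2 0 j end.

Lemma sum_pair (R : realType) (V W : normedModType R) (I : finType)
    (c : I -> R) (F : I -> V * W) :
  \sum_i c i *: F i = (\sum_i c i *: (F i).1, \sum_i c i *: (F i).2).
Proof. by elim/big_rec3: _ => // i x y z _ ->. Qed.

(** The derivatives of [f] along a basis extend continuously to the closure, so
    they are bounded for bounded [p].  The resulting constant is valid on small
    balls of U, whence along segments of U: U need not be convex. *)
Lemma lipschitz_on_slab (R : realType) (n : nat) (U : set 'rV[R]_n)
    (f : 'rV[R]_n * 'rV[R]_n -> R) (P : R) :
  open U -> compact (closure U) ->
  Ck_closure 1 (U `*` [set: 'rV[R]_n]) f ->
  exists2 L : R, 0 <= L & forall x y p q, segment_in U x y -> `|p| < P ->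
    `|q| < P -> `|f (y, q) - f (x, p)| <= L * (`|y - x| + `|q - p|).
Proof.
move=> oU cU [_ df].
have bnd (i : 'I_n + 'I_n) : exists B : R, 0 <= B /\ forall x p, U x -> `|p| < P ->
    `|'D_(prod_basis R i) f (x, p)| <= B.
  have [_ [g gD [cg _]]] := df (prod_basis R i).
  have [B B0 hB] := bounded_on_slab P cU cg.
  exists B; split => // x p Ux pP; rewrite -gD//; apply: hB => //.
  exact: subset_closure.
have [b hb] := choice bnd.
pose B := \sum_i b i.
have B0 : 0 <= B by apply: sumr_ge0 => i _; case: (hb i).
have leB i : b i <= B.
  by rewrite /B (bigD1 i)//= lerDl; apply: sumr_ge0 => j _; case: (hb j).
set N : R := #|{: 'I_n + 'I_n}|%:R.
have BN0 : 0 <= B * N by rewrite mulr_ge0// ler0n.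
exists (B * N) => // x y p q seg pP qP.
pose W := U `*` [set p : 'rV[R]_n | `|p| < P].
have segW : segment_in W (x, p) (y, q).
  move=> t t01; split; first exact: seg.
  by rewrite /= -[X in `|X|]subr0; apply: segment_ball; rewrite ?subr0.
apply: (le_trans (lipschitz_on_segment _ BN0 segW)); last first.
  by rewrite ler_wpM2l// prod_norm_le.
move=> [x0 p0] [/= Ux0 p0P].
have [r r0 hr] := ball_in_open oU Ux0.
pose rho := Num.min r (P - `|p0|).
have rho0 : 0 < rho by rewrite lt_min r0 subr_gt0.
have inW z : `|z - (x0, p0)| < rho -> U z.1 /\ `|z.2| < P.
  rewrite lt_min => /andP[z1 z2]; have [n1 n2] := norm_components_le (z - (x0, p0)).
  split; first by apply: hr; exact: le_lt_trans n1 z1.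
  have := le_lt_trans n2 z2; rewrite /= => h.
  by rewrite -[z.2](subrK p0) (le_lt_trans (ler_normD _ _))// -ltrBrDr.
have N1 : 0 < 2 * N + 1 by rewrite ltr_wpDl// mulr_ge0// ler0n.
exists (rho / (2 * N + 1)); first exact: divr_gt0.
move=> z' hz'.
apply: (@lipschitz_of_basis _ _ _ (@prod_basis R n) (@prod_coord R n) _
  (x0, p0) rho) => //.
- case=> j; rewrite prod_normE /= normr0.
    by rewrite ge_max norm_delta_le1 ler01.
  by rewrite ge_max norm_delta_le1 ler01.
- move=> i z; have [n1 n2] := norm_components_le z.
  by case: i => j /=; [apply: le_trans n1 | apply: le_trans n2]; exact: coord_le_norm.
- move=> [a c]; rewrite big_sumType /= !sum_pair /=.
  rewrite {1}(row_sum_delta a) {1}(row_sum_delta c).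
  congr (_, _).
    by rewrite [X in _ + X]big1 ?addr0// => j _; rewrite scaler0.
  by rewrite [X in X + _]big1 ?add0r// => j _; rewrite scaler0.
- move=> z i hz; have [Uz zP] := inW z hz.
  split; first by have [+ _] := df (prod_basis R i); apply.
  by rewrite (surjective_pairing z) (le_trans _ (leB i))//; case: (hb i) => _; apply.
- by rewrite subrr normr0 divr_gt0.
Qed.

(** * Doubling of variables *)

Lemma within_fst_snd (R : realType) (n : nat) (K : set 'rV[R]_n)
    (u : 'rV[R]_n -> R) :
  {within K, continuous u} ->
  {within K `*` K, continuous (fun z : 'rV[R]_n * 'rV[R]_n => u z.1)} /\
  {within K `*` K, continuous (fun z : 'rV[R]_n * 'rV[R]_n => u z.2)}.
Proof.
move=> /within_continuousP cu.
split; apply/within_continuousP => z [K1 K2] e e0.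
  have [d d0 hd] := cu z.1 K1 e e0; exists d => // y [Ky _] zy.
  by apply: hd => //; exact: le_lt_trans (norm_components_le (z - y)).1 zy.
have [d d0 hd] := cu z.2 K2 e e0; exists d => // y [_ Ky] zy.
by apply: hd => //; exact: le_lt_trans (norm_components_le (z - y)).2 zy.
Qed.

Lemma doubling_max (R : realType) (n : nat) (K : set 'rV[R]_n)
    (u w : 'rV[R]_n -> R) (f xh : 'rV[R]_n) (a b : R) :
  K !=set0 -> compact K -> {within K, continuous u} ->
  {within K, continuous w} ->
  exists x0 y0, [/\ K x0, K y0 & forall x y, K x -> K y ->
    u x + w y - a * dotv (x - y - f) (x - y - f)
      - b * dotv (y - xh) (y - xh) <=
    u x0 + w y0 - a * dotv (x0 - y0 - f) (x0 - y0 - f)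
      - b * dotv (y0 - xh) (y0 - xh)].
Proof.
move=> [k Kk] cK /within_fst_snd[cu _] /within_fst_snd[_ cw].
have KK : K `*` K !=set0 by exists (k, k).
pose Phi z := u z.1 + w z.2 - a * dotv (z.1 - z.2 - f) (z.1 - z.2 - f)
      - b * dotv (z.2 - xh) (z.2 - xh).
have cPhi : {within K `*` K, continuous Phi}.
  apply/subspace_continuousP => z Kz.
  have lift (F : set_system ('rV[R]_n * 'rV[R]_n)) : Filter F ->
      (fun x => x) @ F --> z -> u z'.1 @[z' --> F] --> u z.1 ->
      w z'.2 @[z' --> F] --> w z.2 -> Phi @ F --> Phi z.
    move=> FF Fz hu hw.
    have F1 : z'.1 @[z' --> F] --> z.1 by apply: cvg_comp Fz _; exact: cvg_fst.
    have F2 : z'.2 @[z' --> F] --> z.2 by apply: cvg_comp Fz _; exact: cvg_snd.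
    have F3 : z'.1 - z'.2 - f @[z' --> F] --> z.1 - z.2 - f.
      exact: (cvgB (cvgB F1 F2) (cvg_cst f)).
    have F4 : z'.2 - xh @[z' --> F] --> z.2 - xh.
      exact: (cvgB F2 (cvg_cst xh)).
    have G3 : a * dotv (z'.1 - z'.2 - f) (z'.1 - z'.2 - f) @[z' --> F] -->
        a * dotv (z.1 - z.2 - f) (z.1 - z.2 - f).
      exact: (cvgMr (cvg_dotv FF F3 F3)).
    have G4 : b * dotv (z'.2 - xh) (z'.2 - xh) @[z' --> F] -->
        b * dotv (z.2 - xh) (z.2 - xh).
      exact: (cvgMr (cvg_dotv FF F4 F4)).
    exact: (cvgB (cvgB (cvgD hu hw) G3) G4).
  apply: lift.
  - exact: cvg_within.
  - by move/subspace_continuousP: cu; exact.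
  - by move/subspace_continuousP: cw; exact.
have [[x0 y0] xy hmax] := compact_EVT_max KK (compact_setX cK cK) cPhi.
move: xy; rewrite inE => -[/= Kx Ky].
exists x0, y0; split => // x y Kx' Ky'.
by have := hmax (x, y); rewrite inE; apply; split.
Qed.

(** At a maximum point the penalty [r ^ 2 / (2 dl)] is paid for by Lipschitz
    increments, so that [r] is at most [lam dl] as soon as [lam] exceeds twice the
    total slope. *)
Lemma penalty_radius (R : realType) (r dl lam L L' : R) :
  0 <= r -> 0 < dl -> 0 <= L -> 0 <= L' -> lam = 2 * (L + L') + 1 ->
  (2 * dl)^-1 * r ^+ 2 <= L * r + L' * (lam * dl) ->
  r <= lam * dl.
Proof.
move=> r0 d0 L0 L'0 ->; rewrite mulrC ler_pdivrMr ?mulr_gt0// => h.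
rewrite leNgt; apply/negP => lt.
have r1 : 0 < r by apply: le_lt_trans lt; rewrite mulr_ge0// ?ltW//; lra.
have h1 : (2 * (L + L') + 1) * dl * r < r ^+ 2 by rewrite expr2 ltr_pM2r.
have h2 : L' * dl * ((2 * (L + L') + 1) * dl) <= L' * dl * r.
  by rewrite ler_wpM2l ?(ltW lt)// mulr_ge0// ltW.
have h3 : 0 < dl * r by rewrite mulr_gt0.
have : r ^+ 2 <= 2 * (L * dl * r) + 2 * (L' * dl * ((2 * (L + L') + 1) * dl)).
  apply: (le_trans h); lra.
lra.
Qed.

(** The shift [lam dl e] moves [x0] inside U by more than the Lipschitz bound
    allows it to come back, so that the equation of [u] holds there even if [y0]
    lies on the boundary.  The penalty [K dl |y - xh|^2] keeps [y0] where the
    axis [e] is valid; its factor [dl] makes its effect on the gradient, the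
    difference [q - p], of order [dl]. *)
Lemma doubling_point (R : realType) (n : nat) (U : set 'rV[R]_n)
    (s L lam K dl m : R) (u w : 'rV[R]_n -> R) (xh : 'rV[R]_n) :
  compact (closure U) -> 0 < s -> cone_at U s xh -> 0 <= L ->
  {within closure U, continuous u} -> {within closure U, continuous w} ->
  (forall x y, closure U x -> closure U y -> `|u y - u x| <= L * `|y - x|) ->
  closure U xh -> m = u xh + w xh ->
  (forall y, closure U y -> u y + w y <= m) ->
  lam = 2 * (L + 2 * L * s^-1) + 1 -> 0 < K ->
  lam * (L + 2 * L * s^-1) < K * s ^+ 2 ->
  0 < dl -> lam * dl < s ->
  exists x0 y0 p q : 'rV[R]_n,
    [/\ [/\ closure U y0, U x0 & U y0 -> segment_in U y0 x0],
        [/\ `|x0 - y0| <= lam * (s^-1 + 1) * dl, `|p| <= lam &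
            `|q - p| <= 2 * K * dl * s],
        m - L * (lam * s^-1 * dl) <= u x0 + w y0,
        forall z, closure U z -> u z <= u x0 + dotv p (z - x0)
          + (2 * dl)^-1 * dotv (z - x0) (z - x0) &
        forall z, closure U z -> w z <= w y0 + dotv (- q) (z - y0)
          + ((2 * dl)^-1 + K * dl) * dotv (z - y0) (z - y0)].
Proof.
move=> cU s0 [e eE hcone] L0 cu cw lu cxh mE hm hlam K0 Ks dl0.
set E := s^-1 in eE hlam Ks *; have E0 : 0 < E by rewrite invr_gt0.
move: E eE hlam Ks E0 => E eE hlam Ks E0.
have [L' hL'] : exists L', L' = 2 * L * E by exists (2 * L * E).
rewrite -hL' in hlam Ks.
have L'0 : 0 <= L' by rewrite hL' !mulr_ge0// ltW.
have lam0 : 0 < lam by lra.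
have [tau htau] : exists tau, tau = lam * dl by exists (lam * dl).
rewrite -htau => taus.
have tau0 : 0 < tau by rewrite htau mulr_gt0.
set a := (2 * dl)^-1; have a0 : 0 < a by rewrite invr_gt0 mulr_gt0.
have twoa : 2 * a * dl = 1 by rewrite /a; field; rewrite gt_eqF.
have ha : a = (2 * dl)^-1 by [].
move: a ha a0 twoa => a ha a0 twoa.
have [b hb] : exists b, b = K * dl by exists (K * dl).
have b0 : 0 < b by rewrite hb mulr_gt0.
rewrite -hb.
have KU : closure U !=set0 by exists xh.
have [x0 [y0 [cx0 cy0 hmax]]] := doubling_max (tau *: e) xh a b KU cU cu cw.
pose xi := x0 - y0 - tau *: e; rewrite -/xi in hmax.
have te : `|tau *: e| <= tau * E.
  by rewrite normrZ gtr0_norm// ler_wpM2l ?(ltW tau0).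
have x0y0 : `|x0 - y0| <= `|xi| + tau * E.
  have -> : x0 - y0 = xi + tau *: e by rewrite subrK.
  by rewrite (le_trans (ler_normD _ _))// lerD2l.
have inU0 : U (xh + tau *: e).
  by rewrite -[e]addr0; apply: hcone; rewrite ?subrr ?normr0.
have M0 : m - L * (tau * E) <= u x0 + w y0
    - a * dotv xi xi - b * dotv (y0 - xh) (y0 - xh).
  have := hmax _ xh (subset_closure inU0) cxh.
  have -> : xh + tau *: e - xh - tau *: e = 0.
    by rewrite (addrAC xh) subrr add0r subrr.
  rewrite subrr dotv0l !mulr0 !subr0; apply: le_trans; rewrite mE.
  have := lu _ _ cxh (subset_closure inU0).
  rewrite addrAC subrr add0r ler_norml => /andP[h _].
  have : L * `|tau *: e| <= L * (tau * E) by rewrite ler_wpM2l.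
  lra.
have lu0 : u x0 - u y0 <= L * (`|xi| + tau * E).
  by rewrite (le_trans (ler_norm _))// (le_trans (lu _ _ cy0 cx0))// ler_wpM2l.
have M1 : a * dotv xi xi + b * dotv (y0 - xh) (y0 - xh) <= L * `|xi| + L' * tau.
  by have := hm _ cy0; rewrite hL'; lra.
have aq : a * `|xi| ^+ 2 <= a * dotv xi xi.
  by rewrite ler_wpM2l ?(ltW a0)// norm_le_dotv.
have bq : b * `|y0 - xh| ^+ 2 <= b * dotv (y0 - xh) (y0 - xh).
  by rewrite ler_wpM2l ?(ltW b0)// norm_le_dotv.
have aq0 : 0 <= a * dotv xi xi by rewrite mulr_ge0 ?dotv_ge0 ?(ltW a0).
have bq0 : 0 <= b * dotv (y0 - xh) (y0 - xh) by rewrite mulr_ge0 ?dotv_ge0 ?(ltW b0).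
have gap : m - L * (lam * E * dl) <= u x0 + w y0.
  have -> : lam * E * dl = tau * E by rewrite htau; ring.
  lra.
have xitau : `|xi| <= tau.
  rewrite htau; apply: (penalty_radius _ dl0 L0 L'0 hlam) => //.
  by rewrite -ha -htau; lra.
have y0s : `|y0 - xh| < s.
  rewrite ltNge; apply/negP => h.
  have h1 : b * s ^+ 2 <= b * `|y0 - xh| ^+ 2.
    by rewrite ler_wpM2l ?(ltW b0)// ler_pXn2r ?nnegrE// ltW.
  have h2 : L * `|xi| <= L * tau by rewrite ler_wpM2l.
  have h3 : dl * (lam * (L + L')) < dl * (K * s ^+ 2) by rewrite ltr_pM2l.
  have h4 : b * s ^+ 2 = dl * (K * s ^+ 2) by rewrite hb; ring.
  have h5 : L * tau + L' * tau = dl * (lam * (L + L')) by rewrite htau; ring.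
  lra.
clear M0 M1 lu0 aq bq aq0 bq0.
pose v := tau^-1 *: xi.
have v1 : `|v| <= 1.
  by rewrite normrZ gtr0_norm ?invr_gt0// mulrC ler_pdivrMr// mul1r.
have x0E : x0 = y0 + tau *: (e + v).
  rewrite /v scalerDr scalerA divff ?gt_eqF// scale1r /xi.
  by apply/rowP => j; rewrite !mxE; ring.
exists x0, y0, ((2 * a) *: xi), ((2 * a) *: xi - (2 * b) *: (y0 - xh)).
split=> //; first split.
- by [].
- by rewrite x0E; exact: hcone.
- move=> Uy0 t /andP[t0 t1]; have [->|tN0] := eqVneq t 0.
    by rewrite scale0r addr0.
  have tgt0 : 0 < t by rewrite lt_neqAle eq_sym tN0.
  have -> : y0 + t *: (x0 - y0) = y0 + (t * tau) *: (e + v).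
    by rewrite -scalerA; congr (_ + _ *: _); rewrite x0E addrAC subrr add0r.
  apply: hcone => //; first by rewrite mulr_gt0.
  by apply: le_lt_trans taus; rewrite ger_pMl.
- split.
  + have -> : lam * (E + 1) * dl = tau + tau * E by rewrite htau; ring.
    by rewrite (le_trans x0y0)// lerD2r.
  + rewrite normrZ gtr0_norm ?mulr_gt0//.
    have <- : 2 * a * tau = lam by rewrite htau mulrCA twoa mulr1.
    by rewrite ler_wpM2l ?mulr_ge0 ?(ltW a0).
  + rewrite addrAC subrr add0r normrN normrZ gtr0_norm ?mulr_gt0//.
    by rewrite -(mulrA 2 K) -hb ler_wpM2l ?mulr_ge0 ?(ltW b0) ?(ltW y0s).
- move=> z cz; have := hmax z y0 cz cy0.
  have -> : z - y0 - tau *: e = xi + (z - x0).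
    by rewrite /xi; apply/rowP => j; rewrite !mxE; ring.
  rewrite dotv_sqrD dotvZl; clear; lra.
- move=> z cz; have := hmax x0 z cx0 cz.
  have -> : x0 - z - tau *: e = xi + - (z - y0).
    by rewrite /xi; apply/rowP => j; rewrite !mxE; ring.
  have -> : z - xh = (y0 - xh) + (z - y0) by rewrite [RHS]addrC subrKA.
  move: (z - y0) (y0 - xh) => v2 y1.
  rewrite (dotv_sqrD xi) (dotv_sqrD y1) opprB !(dotvNl, dotvNr, dotvDl, dotvZl).
  clear; lra.
Qed.

(** One gains [alpha m] from the zeroth order terms, the coupling term being
    controlled by [d <= 0] and the maximality of [m], and loses [O(dl)] in the
    Hamiltonian and [n dl + O(dl)] in the viscous term. *)
Lemma doubling (R : realType) (n : nat) (U : set 'rV[R]_n) (s L alpha c d : R)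
    (H : 'rV[R]_n -> 'rV[R]_n -> R) (u1 u2 : 'rV[R]_n -> R) :
  compact (closure U) -> 0 < s <= 1 ->
  (forall x, closure U x -> cone_at U s x) ->
  d <= 0 -> 0 < alpha -> alpha <= c + d ->
  (forall P, exists2 La : R, 0 <= La & forall x y p q, segment_in U x y ->
     `|p| < P -> `|q| < P -> `|H y q - H x p| <= La * (`|y - x| + `|q - p|)) ->
  0 <= L -> {within closure U, continuous u1} ->
  (forall x y, closure U x -> closure U y -> `|u1 y - u1 x| <= L * `|y - x|) ->
  (forall x y, closure U x -> closure U y -> `|u2 y - u2 x| <= L * `|y - x|) ->
  (forall x, bdry U x -> u1 x = 0) ->
  paraboloid_subsol U 0 c d H u1 u2 ->
  exists C dl0 : R, [/\ 0 <= C, 0 < dl0 &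
    forall (dl : R) (w1 w2 : 'rV[R]_n -> R) (xh : 'rV[R]_n),
      0 < dl -> dl < dl0 -> {within closure U, continuous w1} ->
      (forall x, bdry U x -> w1 x = 0) ->
      paraboloid_subsol U (2 * n%:R * dl ^+ 2) c d (reflectH H) w1 w2 ->
      closure U xh ->
      (forall y, closure U y -> u1 y + w1 y <= u1 xh + w1 xh /\
         u2 y + w2 y <= u1 xh + w1 xh) ->
      u1 xh + w1 xh <= C * dl].
Proof.
move=> cU /andP[s0 s1] cone d0 al0 alcd lipH L0 cu1 lu1 lu2 bu1 sub1.
have [lam hlam] : exists lam : R, lam = 2 * (L + 2 * L * s^-1) + 1 by eexists.
have si0 : 0 < s^-1 by rewrite invr_gt0.
have Ls0 : 0 <= 2 * L * s^-1 by rewrite !mulr_ge0// ltW.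
have lam0 : 0 < lam by lra.
have s20 : 0 < s ^+ 2 by rewrite exprn_gt0.
(* [K s ^ 2] exceeds, up to the factor [dl], what the Lipschitz increments can
   pay for, which confines [y0] to the ball of radius [s] around [xh] *)
have [K [K0 Ks]] : exists K : R, 0 < K /\ lam * (L + 2 * L * s^-1) < K * s ^+ 2.
  exists (lam * (L + 2 * L * s^-1) / s ^+ 2 + 1); split.
    apply: ltr_wpDl => //; apply: divr_ge0; last exact: ltW.
    by apply: mulr_ge0; [exact: ltW | exact: addr_ge0].
  rewrite (_ : _ * s ^+ 2 = lam * (L + 2 * L * s^-1) + s ^+ 2) ?ltrDl//.
  by field; rewrite !gt_eqF.
have [La La0 hLa] := lipH (lam + 2 * K + 1).
(* the distance between the two contact points is at most D times dl *)
have [D [D0 hD]] : exists D : R, 0 <= D /\ D = lam * (s^-1 + 1).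
  by eexists; split; last reflexivity; rewrite mulr_ge0 ?addr_ge0 ?(ltW lam0) ?(ltW si0).
have n0 : 0 <= n%:R :> R by rewrite ler0n.
pose C1 := (`|c| + `|d|) * (L * D) + La * (D + 2 * K) + (n%:R + 2 * n%:R * K).
have C10 : 0 <= C1.
  apply: addr_ge0; last by rewrite addr_ge0// !mulr_ge0// ltW.
  have K2 : 0 <= 2 * K by rewrite mulr_ge0// ltW.
  apply: addr_ge0; last by apply: mulr_ge0 => //; exact: addr_ge0.
  by apply: mulr_ge0; [exact: addr_ge0 | exact: mulr_ge0].
have C1a : 0 <= C1 / alpha by rewrite divr_ge0// ltW.
exists (C1 / alpha + 2 * (L * D)), (Num.min 1 (s / lam)); split.
- by rewrite addr_ge0// !mulr_ge0.
- by rewrite lt_min ltr01 divr_gt0.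
move=> dl w1 w2 xh dl0; rewrite lt_min ltr_pdivlMr// (mulrC dl) => /andP[dl1 dls].
move=> cw1 bw1 sub2 cxh hm; have [m mE] : exists m : R, m = u1 xh + w1 xh by eexists.
rewrite -mE in hm *.
have hm1 y : closure U y -> u1 y + w1 y <= m by move/hm => [].
have [x0 [y0 [p [q [[cy0 Ux0 seg] [dist pn qp] gap touch1 touch2]]]]] :=
  doubling_point cU s0 (cone _ cxh) L0 cu1 cw1 lu1 cxh mE hm1 hlam K0 Ks dl0 dls.
have cx0 := subset_closure Ux0.
rewrite -hD in dist.
have gapD : m - L * D * dl <= u1 x0 + w1 y0.
  apply: le_trans gap; rewrite lerD2l lerN2 -(mulrA L D) ler_wpM2l//.
  rewrite ler_wpM2r ?(ltW dl0)//.
  by rewrite hD ler_wpM2l ?(ltW lam0)// lerDl.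
have near (u : 'rV[R]_n -> R) :
    (forall x y, closure U x -> closure U y -> `|u y - u x| <= L * `|y - x|) ->
    u x0 - u y0 <= L * D * dl.
  move=> lu; rewrite (le_trans (ler_norm _))// (le_trans (lu _ _ cy0 cx0))//.
  by rewrite -mulrA ler_wpM2l.
have near1 := near _ lu1; have near2 := near _ lu2.
have [h1 h2] := hm _ cy0.
have LD0 : 0 <= L * D * dl by rewrite !mulr_ge0// ltW.
have mneg_ok : m <= 0 -> m <= (C1 / alpha + 2 * (L * D)) * dl.
  by move=> /le_trans; apply; rewrite mulr_ge0 ?(ltW dl0)// addr_ge0// !mulr_ge0.
have [Uy0|nUy0] := pselect (U y0); last first.
  have by0 : bdry U y0 by split => // /interior_subset.
  have : m <= 2 * (L * D) * dl.
    by move: gapD near1; rewrite (bu1 _ by0) (bw1 _ by0); clear; lra.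
  move=> h; apply: (le_trans h); rewrite [leRHS]mulrDl lerDr.
  by rewrite mulr_ge0 ?(ltW dl0).
have contact1 := sub1 _ _ _ Ux0 touch1; rewrite mul0r in contact1.
have contact2 := sub2 _ _ _ Uy0 touch2; rewrite /reflectH opprK in contact2.
have qpK : `|q - p| <= 2 * K * dl.
  by rewrite (le_trans qp)// ler_piMr// !mulr_ge0// ltW.
have qn : `|q| < lam + 2 * K + 1.
  rewrite -[q](subrK p) (le_lt_trans (ler_normD _ _))//.
  have : 2 * K * dl <= 2 * K by rewrite ler_piMr ?mulr_ge0 ?(ltW dl1) ?(ltW K0).
  move: qpK pn; clear; lra.
have pn' : `|p| < lam + 2 * K + 1.
  by move: pn K0; clear; lra.
have hH : H y0 q - H x0 p <= La * (D + 2 * K) * dl.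
  have := hLa _ _ q p (seg Uy0) qn pn'; rewrite ler_norml => /andP[+ _].
  rewrite (distrC p) => h; have : La * (`|x0 - y0| + `|q - p|) <= La * (D + 2 * K) * dl.
    by rewrite -mulrA ler_wpM2l// mulrDl lerD.
  move: h; clear; lra.
have nu : 2 * n%:R * dl ^+ 2 * ((2 * dl)^-1 + K * dl) <= (n%:R + 2 * n%:R * K) * dl.
  have -> : 2 * n%:R * dl ^+ 2 * ((2 * dl)^-1 + K * dl) = n%:R * dl +
     2 * n%:R * K * dl * dl ^+ 2 by field; rewrite gt_eqF.
  rewrite [leRHS]mulrDl lerD2l ler_piMr//; last by rewrite expr_le1// ltW.
  by rewrite !mulr_ge0 ?(ltW dl0) ?(ltW K0).
have S1 : c * m - `|c| * (L * D * dl) <= c * (u1 x0 + w1 y0).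
  rewrite lerBlDr -lerBlDl -mulrBr (le_trans (ler_norm _))// normrM ler_wpM2l//.
  rewrite ler_norml; apply/andP; move: near1 h1 gapD; clear; split; lra.
have S2 : d * m - `|d| * (L * D * dl) <= d * (u2 x0 + w2 y0).
  have : d * (m + L * D * dl) <= d * (u2 x0 + w2 y0).
    by rewrite ler_wnM2l//; move: near2 h2; clear; lra.
  by rewrite ler0_norm//; clear; lra.
have fin : (c + d) * m <= C1 * dl.
  by move: S1 S2 nu contact1 contact2 hH; rewrite /C1; clear; lra.
have [mneg|mpos] := ltP m 0; first exact/mneg_ok/ltW.
have am : alpha * m <= C1 * dl by rewrite (le_trans _ fin)// ler_wpM2r.
rewrite mulrDl; apply: (@le_trans _ _ (C1 / alpha * dl)).
  by rewrite mulrAC ler_pdivlMr// mulrC.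
by rewrite lerDl !mulr_ge0 ?(ltW dl0).
Qed.

(** * The rate of convergence *)

Lemma coercive_lipschitz (R : realType) (n : nat) (U : set 'rV[R]_n) (s c d : R)
    (H : 'rV[R]_n -> 'rV[R]_n -> R) (u w : 'rV[R]_n -> R) :
  open U -> compact (closure U) -> 0 < s ->
  (forall x, closure U x -> cone_at U s x) ->
  unif_pinfty (closure U) (fun x p => H x p / enorm p) ->
  {within closure U, continuous u} -> {within closure U, continuous w} ->
  paraboloid_subsol U 0 c d H u w ->
  exists2 L : R, 0 <= L & forall x y, closure U x -> closure U y ->
    `|u y - u x| <= L * `|y - x|.
Proof.
move=> oU cU s0 cone coer cu cw sub.
have [M1 M10 hM1] := compact_continuous_bounded cU cu.
have [M2 M20 hM2] := compact_continuous_bounded cU cw.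
have hM z : closure U z -> `|u z| <= M1 + M2 /\ `|w z| <= M1 + M2.
  by move=> cz; have := hM1 z cz; have := hM2 z cz; lra.
have [G G0 hG] := slope_of_coercive coer hM sub.
have nG0 : 0 <= n%:R * G by rewrite mulr_ge0.
apply: (lipschitz_on_closure cU cu s0 cone nG0) => x y.
apply: lipschitz_on_segment => // z Uz.
have [r r0 hr] := locally_lipschitz_of_slopes oU cU cu hG G0 Uz.
exists r => // z' z'z; apply: hr => //.
by rewrite subrr normr0.
Qed.

Definition lipschitz_slab (R : realType) (n : nat) (U : set 'rV[R]_n)
    (H : 'rV[R]_n -> 'rV[R]_n -> R) : Prop :=
  forall P : R, exists2 La : R, 0 <= La & forall x y p q, segment_in U x y ->
    `|p| < P -> `|q| < P -> `|H y q - H x p| <= La * (`|y - x| + `|q - p|).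

Definition system_subsol (R : realType) (n : nat) (U : set 'rV[R]_n)
    (H1 H2 : 'rV[R]_n -> 'rV[R]_n -> R) (c11 c12 c21 c22 nu : R)
    (w1 w2 : 'rV[R]_n -> R) : Prop :=
  [/\ {within closure U, continuous w1} /\ {within closure U, continuous w2},
      forall x, bdry U x -> w1 x = 0 /\ w2 x = 0,
      paraboloid_subsol U nu c11 c12 H1 w1 w2 &
      paraboloid_subsol U nu c22 c21 H2 w2 w1].

Lemma reflectHK (R : realType) (n : nat) (H : 'rV[R]_n -> 'rV[R]_n -> R) :
  reflectH (reflectH H) = H.
Proof. by apply/funext => x; apply/funext => p; rewrite /reflectH !opprK. Qed.

(** At the largest value of both components, the coupling [d <= 0] leaves
    [(c + d) w1 xh <= - H xh 0]. *)
Lemma max_principle (R : realType) (n : nat) (U : set 'rV[R]_n)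
    (nu c d alpha B : R) (H : 'rV[R]_n -> 'rV[R]_n -> R)
    (w1 w2 : 'rV[R]_n -> R) (xh : 'rV[R]_n) :
  d <= 0 -> 0 < alpha -> alpha <= c + d -> 0 <= B ->
  (forall x, closure U x -> `|H x 0| <= B) ->
  (forall x, bdry U x -> w1 x = 0) -> paraboloid_subsol U nu c d H w1 w2 ->
  closure U xh -> (forall y, closure U y -> w1 y <= w1 xh /\ w2 y <= w1 xh) ->
  w1 xh <= B / alpha.
Proof.
move=> d0 al0 alcd B0 hB bw sub cxh hm.
have BA : 0 <= B / alpha by rewrite divr_ge0// ltW.
have [Ux|nUx] := pselect (U xh); last first.
  by rewrite bw//; split => // /interior_subset.
have h : c * w1 xh + d * w2 xh + H xh 0 <= 0.
  rewrite -(mulr0 nu); apply: sub => // z cz.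
  by rewrite dotv0l mul0r !addr0; case: (hm z cz).
 have [neg|pos] := ltP (w1 xh) 0; first exact: le_trans (ltW neg) BA.
rewrite ler_pdivlMr//.
have [_ h2] := hm _ cxh.
have h3 : d * w1 xh <= d * w2 xh by rewrite ler_wnM2l.
have h4 : w1 xh * alpha <= w1 xh * (c + d) by rewrite ler_wpM2l.
have := hB _ cxh; rewrite ler_norml => /andP[h5 _]; lra.
Qed.

(** For small [dl] the doubling argument applies to the component that carries
    the largest of the two maxima; for larger [dl] the sums are bounded, by the
    maximum principle, and [dl] is bounded below. *)
Lemma one_sided_rate (R : realType) (n : nat) (U : set 'rV[R]_n)
    (H1 H2 : 'rV[R]_n -> 'rV[R]_n -> R) (c11 c12 c21 c22 alpha s L B : R)
    (u1 u2 : 'rV[R]_n -> R) :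
  U !=set0 -> compact (closure U) -> 0 < s <= 1 ->
  (forall x, closure U x -> cone_at U s x) ->
  c12 <= 0 -> c21 <= 0 -> 0 < alpha -> alpha <= c11 + c12 ->
  alpha <= c22 + c21 -> lipschitz_slab U H1 -> lipschitz_slab U H2 ->
  0 <= B -> (forall x, closure U x -> `|H1 x 0| <= B /\ `|H2 x 0| <= B) ->
  0 <= L ->
  (forall x y, closure U x -> closure U y -> `|u1 y - u1 x| <= L * `|y - x|) ->
  (forall x y, closure U x -> closure U y -> `|u2 y - u2 x| <= L * `|y - x|) ->
  system_subsol U H1 H2 c11 c12 c21 c22 0 u1 u2 ->
  exists2 C : R, 0 <= C & forall (dl : R) (w1 w2 : 'rV[R]_n -> R), 0 < dl ->
    system_subsol U (reflectH H1) (reflectH H2) c11 c12 c21 c22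
      (2 * n%:R * dl ^+ 2) w1 w2 ->
    forall x, closure U x -> u1 x + w1 x <= C * dl /\ u2 x + w2 x <= C * dl.
Proof.
move=> [x00 Ux00] cU hs cone d1 d2 al0 al1 al2 lip1 lip2 B0 hB L0 lu1 lu2.
move=> [[cu1 cu2] bu sub1 sub2].
have bu1 x : bdry U x -> u1 x = 0 by case/bu.
have bu2 x : bdry U x -> u2 x = 0 by case/bu.
have K0 : closure U !=set0 by exists x00; exact: subset_closure.
have [C1 [dl1 [C10 dl10 hC1]]] :=
  doubling cU hs cone d1 al0 al1 lip1 L0 cu1 lu1 lu2 bu1 sub1.
have [C2 [dl2 [C20 dl20 hC2]]] :=
  doubling cU hs cone d2 al0 al2 lip2 L0 cu2 lu2 lu1 bu2 sub2.
have [M1 M10 hM1] := compact_continuous_bounded cU cu1.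
have [M2 M20 hM2] := compact_continuous_bounded cU cu2.
have [dl0 [dl00 dl01 dl02]] : exists dl0 : R, [/\ 0 < dl0, dl0 <= dl1 & dl0 <= dl2].
  by exists (Num.min dl1 dl2); rewrite lt_min dl10 dl20 !ge_min !lexx orbT.
have BA : 0 <= B / alpha by rewrite divr_ge0// ltW.
have M0 : 0 <= (M1 + M2 + B / alpha) / dl0.
  by apply: divr_ge0; [apply: addr_ge0 => //; exact: addr_ge0 | exact: ltW].
exists (C1 + C2 + (M1 + M2 + B / alpha) / dl0); first by rewrite !addr_ge0.
move=> dl w1 w2 dlgt0 [[cw1 cw2] bw subw1 subw2] x cx.
have bw1 y : bdry U y -> w1 y = 0 by case/bw.
have bw2 y : bdry U y -> w2 y = 0 by case/bw.
have C1dl : 0 <= C1 * dl by rewrite mulr_ge0// ltW.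
have C2dl : 0 <= C2 * dl by rewrite mulr_ge0// ltW.
have [small|large] := ltP dl dl0.
  have M0dl : 0 <= (M1 + M2 + B / alpha) / dl0 * dl by rewrite mulr_ge0// ltW.
  have csum (u w : 'rV[R]_n -> R) : {within closure U, continuous u} ->
      {within closure U, continuous w} -> {within closure U, continuous (u \+ w)}.
    by move=> cu cw y; apply: cvgD; [exact: cu | exact: cw].
  have [xh cxh [hm|hm]] := max_of_two K0 cU (csum _ _ cu1 cw1) (csum _ _ cu2 cw2).
    have := hC1 dl w1 w2 xh dlgt0 (lt_le_trans small dl01) cw1 bw1 subw1 cxh hm.
    by have [/= ? ?] := hm x cx; lra.
  have := hC2 dl w2 w1 xh dlgt0 (lt_le_trans small dl02) cw2 bw2 subw2 cxh hm.
  by have [/= ? ?] := hm x cx; lra.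
have Mdl : M1 + M2 + B / alpha <= (M1 + M2 + B / alpha) / dl0 * dl.
  by rewrite -[leLHS](divfK (lt0r_neq0 dl00)) ler_wpM2l.
have reflB (H : 'rV[R]_n -> 'rV[R]_n -> R) y : `|H y 0| <= B -> `|reflectH H y 0| <= B.
  by rewrite /reflectH oppr0 normrN.
have hB1 y : closure U y -> `|reflectH H1 y 0| <= B by move/hB => [? _]; exact: reflB.
have hB2 y : closure U y -> `|reflectH H2 y 0| <= B by move/hB => [_ ?]; exact: reflB.
have [hw1 hw2] : w1 x <= B / alpha /\ w2 x <= B / alpha.
  have [xh cxh [hm|hm]] := max_of_two K0 cU cw1 cw2; have [i1 i2] := hm x cx.
    have top := max_principle d1 al0 al1 B0 hB1 bw1 subw1 cxh hm.
    by split; exact: le_trans top.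
  have top := max_principle d2 al0 al2 B0 hB2 bw2 subw2 cxh hm.
  by split; exact: le_trans top.
have := hM1 x cx; have := hM2 x cx; rewrite !ler_norml.
move=> /andP[_ i2] /andP[_ i1]; lra.
Qed.

Lemma null_set_empty (R : realType) (n : nat) : (0 < n)%N ->
  Defs.null_set (set0 : set 'rV[R]_n).
Proof.
move=> n0 e e0; exists (fun=> 0), (fun=> 0); split => //.
rewrite eseries0 ?lee_fin ?ltW// => k _ _.
case: n n0 => // n _.
by rewrite big_ord_recl !mxE subrr mul0r.
Qed.

Lemma Linfty_norm_le (R : realType) (n : nat) (U : set 'rV[R]_n)
    (f : 'rV[R]_n -> R) (M : R) : (0 < n)%N -> 0 <= M ->
  (forall x, U x -> `|f x| <= M) -> (Linfty_norm U f <= M%:E)%E.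
Proof.
move=> n0 M0 hf; apply: ereal_inf_lbound; exists M => //; split => //.
rewrite (_ : _ `&` _ = set0); first exact: null_set_empty.
by apply/seteqP; split => // x [/hf + /=]; rewrite leNgt => /negP.
Qed.

Theorem theorem3p5 (R : realType) (n : nat) (hn : (2 <= n)%N)
  (U : set 'rV[R]_n) (hU : smooth_bounded_domain U)
  (H1 H2 : 'rV[R]_n -> 'rV[R]_n -> R)
  (hH1 : smooth_closure (U `*` [set: 'rV[R]_n]) (fun z => H1 z.1 z.2))
  (hH2 : smooth_closure (U `*` [set: 'rV[R]_n]) (fun z => H2 z.1 z.2))
  (c11 c12 c21 c22 : R)
  (hgrowth : exists beta1 beta2 : R, [/\ 0 < beta1, 0 < beta2,
      unif_pinfty (closure U) (fun x p =>
        beta1 * `|H1 x p| ^+ 2 + dotv (grad_closure U (fun y => H1 y p) x) p)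
      /\ unif_pinfty (closure U) (fun x p => H1 x p / enorm p) &
      unif_pinfty (closure U) (fun x p =>
        beta2 * `|H2 x p| ^+ 2 + dotv (grad_closure U (fun y => H2 y p) x) p)
      /\ unif_pinfty (closure U) (fun x p => H2 x p / enorm p)])
  (hc : c12 <= 0 /\ c21 <= 0)
  (halpha : exists alpha : R,
      [/\ 0 < alpha, alpha <= c11 + c12 & alpha <= c21 + c22])
  (hPhi : exists Phi1 Phi2 : 'rV[R]_n -> R,
      [/\ Ck 2 U Phi1 /\ Ck_closure 1 U Phi1,
          Ck 2 U Phi2 /\ Ck_closure 1 U Phi2,
          forall x, bdry U x -> Phi1 x = 0 /\ Phi2 x = 0 &
          forall x, U x ->
            c11 * Phi1 x + c12 * Phi2 x + H1 x (grad Phi1 x) < 0 /\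
            c22 * Phi2 x + c21 * Phi1 x + H2 x (grad Phi2 x) < 0])
  (u1 u2 : 'rV[R]_n -> R)
  (hu : visc_system_sol U H1 H2 c11 c12 c21 c22 u1 u2) :
  exists C : R, 0 < C /\
    forall (eps : R) (v1 v2 : 'rV[R]_n -> R), 0 < eps ->
      smooth_system_sol U H1 H2 c11 c12 c21 c22 eps v1 v2 ->
      (Linfty_norm U (fun x => v1 x - u1 x)%R <= (C * Num.sqrt eps)%:E)%E /\
      (Linfty_norm U (fun x => v2 x - u2 x)%R <= (C * Num.sqrt eps)%:E)%E.
Proof.
have [oU U0 _ bU _] := hU.
have cU := compact_closure_bounded bU.
have [s hs cone] := uniform_cone hU; have /andP[s0 s1] := hs.
have [_ [_ [_ _ [_ coer1] [_ coer2]]]] := hgrowth.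
have [d1 d2] := hc; have [al [al0 al1 al2]] := halpha.
rewrite addrC in al2.
have [[cu1 cu2] vis1 vis2 bu] := hu.
have {}vis2 : visc_sol U (fun x r p => c22 * r + c21 * u1 x + H2 x p) u2.
  have <- : (fun x r p => c21 * u1 x + c22 * r + H2 x p) =
            (fun x r p => c22 * r + c21 * u1 x + H2 x p) :> (_ -> R -> _ -> R).
    apply/funext => x; apply/funext => r; apply/funext => p.
    by rewrite (addrC (c21 * _)).
  exact: vis2.
have [sub1 sup1] := visc_sol_paraboloid oU vis1.
have [sub2 sup2] := visc_sol_paraboloid oU vis2.
have [L1 L10 lu1] := coercive_lipschitz oU cU s0 cone coer1 cu1 cu2 sub1.
have [L2 L20 lu2] := coercive_lipschitz oU cU s0 cone coer2 cu2 cu1 sub2.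
have L0 : 0 <= L1 + L2 by rewrite addr_ge0.
have lip (u : 'rV[R]_n -> R) (Lu : R) : Lu <= L1 + L2 ->
    (forall x y, closure U x -> closure U y -> `|u y - u x| <= Lu * `|y - x|) ->
    (forall x y, closure U x -> closure U y -> `|u y - u x| <= (L1 + L2) * `|y - x|) /\
    (forall x y, closure U x -> closure U y ->
       `|(\- u) y - (\- u) x| <= (L1 + L2) * `|y - x|).
  move=> LuL lu; have lu' x y : closure U x -> closure U y ->
      `|u y - u x| <= (L1 + L2) * `|y - x|.
    by move=> cx cy; apply: (le_trans (lu x y cx cy)); rewrite ler_wpM2r.
  split=> // x y cx cy; rewrite /= -opprD normrN; exact: lu'.
have [{}lu1 lun1] := lip u1 L1 ltac:(lra) lu1.
have [{}lu2 lun2] := lip u2 L2 ltac:(lra) lu2.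
have lipH (H : 'rV[R]_n -> 'rV[R]_n -> R) :
    smooth_closure (U `*` [set: 'rV[R]_n]) (fun z => H z.1 z.2) ->
    [/\ lipschitz_slab U H, lipschitz_slab U (reflectH H) &
        exists2 B : R, 0 <= B & forall x, closure U x -> `|H x 0| <= B].
  move=> sH; have lH : lipschitz_slab U H.
    by move=> P; exact: (lipschitz_on_slab P oU cU (sH 1%N)).
  split=> //.
    move=> P; have [La La0 hLa] := lH P; exists La => // x y p q seg pP qP.
    rewrite /reflectH -opprD normrN -(normrN (q - p)) opprD.
    by apply: hLa => //; rewrite normrN.
  have [B B0 hB] := bounded_on_slab 1 cU (sH 0%N).1.
  by exists B => // x cx; apply: (hB x 0 cx); rewrite normr0.
have [lH1 lHn1 [B1 B10 hB1]] := lipH _ hH1.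
have [lH2 lHn2 [B2 B20 hB2]] := lipH _ hH2.
have B0 : 0 <= B1 + B2 by rewrite addr_ge0.
have hB x : closure U x -> `|H1 x 0| <= B1 + B2 /\ `|H2 x 0| <= B1 + B2.
  by move=> cx; have := hB1 x cx; have := hB2 x cx; lra.
have hBn x : closure U x ->
    `|reflectH H1 x 0| <= B1 + B2 /\ `|reflectH H2 x 0| <= B1 + B2.
  by rewrite /reflectH oppr0 !normrN; exact: hB.
have sysu : system_subsol U H1 H2 c11 c12 c21 c22 0 u1 u2 by split.
have sysun : system_subsol U (reflectH H1) (reflectH H2) c11 c12 c21 c22 0
    (\- u1) (\- u2).
  split=> //; first by split; exact: within_continuousN.
  by move=> x /bu[/= -> ->]; rewrite oppr0.
(* [u - v] is bounded by applying the estimate to [u] and [- v], and [v - u] by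
   applying it to [- u] and [v] *)
have [C C0 hC] := one_sided_rate U0 cU hs cone d1 d2 al0 al1 al2 lH1 lH2 B0 hB
  L0 lu1 lu2 sysu.
have [C' C'0 hC'] := one_sided_rate U0 cU hs cone d1 d2 al0 al1 al2 lHn1 lHn2
  B0 hBn L0 lun1 lun2 sysun.
exists (C + C' + 1); split; first lra.
move=> eps v1 v2 eps0 [[sv1 sv2] [cv1 cv2] pde bv].
pose dl := Num.sqrt eps; have dl0 : 0 < dl by rewrite sqrtr_gt0.
have dlE : dl ^+ 2 = eps by rewrite sqr_sqrtr// ltW.
have [vs1 vp1] := smooth_sol_paraboloid oU sv1 (ltW eps0)
  (fun x Ux => (pde x Ux).1).
have pde2 x : U x -> c22 * v2 x + c21 * v1 x + H2 x (grad v2 x) = eps * laplacian v2 x.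
  by move=> /pde[_ <-]; rewrite (addrC (c22 * _)).
have [vs2 vp2] := smooth_sol_paraboloid oU sv2 (ltW eps0) pde2.
rewrite -dlE in vs1 vs2 vp1 vp2.
have sysv : system_subsol U (reflectH (reflectH H1)) (reflectH (reflectH H2))
    c11 c12 c21 c22 (2 * n%:R * dl ^+ 2) v1 v2 by rewrite !reflectHK; split.
have sysvn : system_subsol U (reflectH H1) (reflectH H2) c11 c12 c21 c22
    (2 * n%:R * dl ^+ 2) (\- v1) (\- v2).
  split=> //; first by split; exact: within_continuousN.
  by move=> x /bv[/= -> ->]; rewrite oppr0.
have n0 : (0 < n)%N by apply: leq_trans hn.
have Cdl : 0 <= C * dl by rewrite mulr_ge0// ltW.
have C'dl : 0 <= C' * dl by rewrite mulr_ge0// ltW.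
have M0 : 0 <= (C + C' + 1) * dl by rewrite mulr_ge0 ?addr_ge0 ?(ltW dl0).
split; apply: Linfty_norm_le => // x /(@subset_closure _ U) cx.
  have [/= i1 _] := hC _ _ _ dl0 sysvn x cx.
  have [/= j1 _] := hC' _ _ _ dl0 sysv x cx.
  rewrite -/dl ler_norml; apply/andP.
  by move: i1 j1 Cdl C'dl dl0; clear; split; lra.
have [/= _ i2] := hC _ _ _ dl0 sysvn x cx.
have [/= _ j2] := hC' _ _ _ dl0 sysv x cx.
rewrite -/dl ler_norml; apply/andP.
by move: i2 j2 Cdl C'dl dl0; clear; split; lra.
Qed.
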